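(* Let $l\ge 2$ and let $u_1,\dots,u_l\in\mathbb{C}^2$, $u_j=(u_j^{(1)},u_j^{(2)})$, be row vectors of variables. Consider the space of polynomials in $(u_1,\dots,u_l)$ with the inner product in which monomials are pairwise orthogonal and $\|\prod_j (u_j^{(1)})^{a_j}(u_j^{(2)})^{b_j}\|^2=\prod_j a_j!\,b_j!$; the homogeneous component of multidegree $(n_1,\dots,n_l)$ (degree $n_j$ in $u_j$) is $V_{n_1}\otimes\cdots\otimes V_{n_l}$, on which $\mathrm{SU}(2)^l$ acts by $\big(\bigotimes_j T(A_j)\big)f(u_1,\dots,u_l)=f(u_1A_1,\dots,u_lA_l)$. For $i<j$ put $\xi_{ij}(u)=u_i^{(1)}u_j^{(2)}-u_i^{(2)}u_j^{(1)}$. For a symmetric $l\times l$ matrix $\alpha=(\alpha_{ij})$ of nonnegative integers with zero diagonal put $\Xi[\alpha]=\prod_{i<j}\xi_{ij}^{\alpha_{ij}}$, which lies in $V_{n_1}\otimes\cdots\otimes V_{n_l}$ with $n_i=\sum_j\alpha_{ij}$. For two such matrices $\alpha,\beta$ with $\sum_j\alpha_{ij}=\sum_j\beta_{ij}$ for all $i$, and $A_1,\dots,A_l\in\mathrm{SU}(2)$, put $$\Phi[\alpha,\beta](A_1,\dots,A_l)=\Big\langle \Big(\bigotimes_j T(A_j)\Big)\Xi[\alpha],\ \Xi[\beta]\Big\rangle .$$ For complex numbers $t_{ij}$ ($i<j$) let $T$ be the $2l\times 2l$ matrix composed of $2\times2$ blocks $T_{ij}$, where $T_{ij}=\begin{pmatrix}0&t_{ij}\\-t_{ij}&0\end{pmatrix}$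 for $i<j$, $T_{ii}=0$, $T_{ji}=-T_{ij}$; let $\overline{T'}$ be the analogous matrix built from the numbers $\overline{t'_{ij}}$; and let $U=\mathrm{diag}(A_1,\dots,A_l)$ (block diagonal). Then, for all $t_{ij},t'_{ij}$ sufficiently close to $0$ (with the branch of the square root equal to $1$ at $t=t'=0$), $$\sum_{n_1,\dots,n_l\ge 0}\ \sum_{\alpha:\,\sum_j\alpha_{ij}=n_i}\ \sum_{\beta:\,\sum_j\beta_{ij}=n_i}\ \Big(\prod_{i<j}\frac{t_{ij}^{\alpha_{ij}}\,\overline{t'_{ij}}^{\,\beta_{ij}}}{\alpha_{ij}!\,\beta_{ij}!}\Big)\Phi[\alpha,\beta](A_1,\dots,A_l)=\det\big(1-UTU^t\,\overline{T'}\big)^{-1/2},$$ where $\alpha,\beta$ range over symmetric nonnegative integer matrices with zero diagonal. *)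

(* Defs.v *)
From HB Require Import structures.
From mathcomp Require Import all_boot all_order all_algebra.
From mathcomp Require Import reals.
From mathcomp.real_closed Require Import complex.
From mathcomp.multinomials Require Import mpoly.

Set Implicit Arguments.
Unset Strict Implicit.
Unset Printing Implicit Defensive.

Import Order.TTheory GRing.Theory Num.Theory.
Local Open Scope ring_scope.

Section Defs.
Variable R : rcfType.
Local Notation C := R[i].

Definition o1 : 'I_2 := @Ordinal 2 1 erefl.

(* The variable u_j^{(c+1)} (j : 'I_l, c : 'I_2) is the variable number
   mxvec_index j c among the 2l variables. *)
Definition uvar (l : nat) (j : 'I_l) (c : 'I_2) : 'I_(l * 2) := mxvec_index j c.

Definition fischer (l : nat) (f g : {mpoly C[l * 2]}) : C :=
  \sum_(m <- msupp f) f@_m * Num.conj (g@_m) * (\prod_(k < l * 2) (m k)`!)%:R.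

(* (tensor_j T(A_j)) f (u_1,...,u_l) = f(u_1 A_1, ..., u_l A_l), u_j row vectors:
   the variable u_j^{(k)} is replaced by sum_c u_j^{(c)} (A_j)_{c k}. *)
Definition Tact (l : nat) (A : 'I_l -> 'M[C]_2) (f : {mpoly C[l * 2]})
  : {mpoly C[l * 2]} :=
  f \mPo [tuple (mxvec (\matrix_(j < l, k < 2)
                   \sum_(c < 2) 'X_(uvar j c) * (A j c k)%:MP)) 0 p | p < l * 2].

Definition xi (l : nat) (i j : 'I_l) : {mpoly C[l * 2]} :=
  'X_(uvar i ord0) * 'X_(uvar j o1) - 'X_(uvar i o1) * 'X_(uvar j ord0).

Definition Xi (l : nat) (alpha : 'M[nat]_l) : {mpoly C[l * 2]} :=
  \prod_(i < l) \prod_(j < l | (i < j)%N) xi i j ^+ alpha i j.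

Definition Phi (l : nat) (alpha beta : 'M[nat]_l) (A : 'I_l -> 'M[C]_2) : C :=
  fischer (Tact A (Xi alpha)) (Xi beta).

Definition admissible (l : nat) (n : 'I_l -> nat) (alpha : 'M[nat]_l) : bool :=
  [forall i, alpha i i == 0%N] &&
  [forall i, forall j, alpha i j == alpha j i] &&
  [forall i, (\sum_(j < l) alpha i j)%N == n i].

Definition weight (l : nat) (t t' : 'I_l -> 'I_l -> C) (alpha beta : 'M[nat]_l) : C :=
  \prod_(i < l) \prod_(j < l | (i < j)%N)
     (t i j ^+ alpha i j * Num.conj (t' i j) ^+ beta i j
        / ((alpha i j)`! * (beta i j)`!)%:R).

(* The (finite) coefficient of the multi-index n = (n_1,...,n_l):
   sum over admissible alpha, beta with row sums n.  Every entry of an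
   admissible matrix is <= sum_i n_i, so enumerating matrices with entries in
   'I_(sum_i n_i).+1 enumerates all of them exactly once. *)
Definition gen_coef (l : nat) (t t' : 'I_l -> 'I_l -> C) (A : 'I_l -> 'M[C]_2)
  (n : 'I_l -> nat) : C :=
  \sum_(a : 'M['I_(\sum_(i < l) n i).+1]_l | admissible n (map_mx val a))
   \sum_(b : 'M['I_(\sum_(i < l) n i).+1]_l | admissible n (map_mx val b))
     weight t t' (map_mx val a) (map_mx val b) * Phi (map_mx val a) (map_mx val b) A.

Definition skew2 (x : C) : 'M[C]_2 :=
  \matrix_(a < 2, b < 2)
    (if (a == ord0) && (b == o1) then x
     else if (a == o1) && (b == ord0) then - x else 0).

Definition Tmat (l : nat) (t : 'I_l -> 'I_l -> C) : 'M[C]_(\sum_(i < l) 2) :=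
  @mxblock C l l (fun _ => 2%N) (fun _ => 2%N)
    (fun i j => if (i < j)%N then skew2 (t i j)
                else if (j < i)%N then - skew2 (t j i) else 0).

Definition Umat (l : nat) (A : 'I_l -> 'M[C]_2) : 'M[C]_(\sum_(i < l) 2) :=
  @mxdiag C l (fun _ => 2%N) A.

(* principal branch of the square root (the root with positive real part);
   near 1 this is the continuous branch equal to 1 at 1 *)
Definition psqrt (z : C) : C :=
  let w := sqrtC z in if 'Re w < 0 then - w else w.

Definition is_SU2 (A : 'M[C]_2) : Prop :=
  A *m (map_mx Num.conj A)^T = 1%:M /\ \det A = 1.

End Defs.

(* Main.v *)
Require Import Defs.
From HB Require Import structures.
From mathcomp Require Import all_boot all_order all_algebra.
From mathcomp Require Import reals.
From mathcomp.real_closed Require Import complex.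
From mathcomp.multinomials Require Import mpoly.
From mathcomp Require Import perm ring zify.
Import Order.TTheory GRing.Theory Num.Theory.
Local Open Scope ring_scope.

Set Implicit Arguments.
Unset Strict Implicit.
Unset Printing Implicit Defensive.

(** Let [S = U T U^t] and let [p_m], [r_m] be the [m]-th divided powers of the
    quadratic forms [u S u^t / 2] and [u T' u^t / 2]. By the multinomial theorem
    the coefficient of multidegree [n] in the series is the inner product of
    the components of multidegree [n] of [p_m] and [r_m], where
    [2m = n_1 + ... + n_l], so the series is [sum_m c_m], [c_m = <p_m, r_m>].
    Multiplication by a variable is adjoint to differentiation, so the matrices
    [G_m = (<u_i p_m, u_j r_m>)] satisfy [G_(m+1) = c_(m+1) + G_m M] and
    [2(m+1) c_(m+1) = tr (G_m M)] with [M = conj(T') S]. In terms of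
    [c(z) = sum_m c_m z^m] this reads [2 c' = c tr ((1 - zM)^-1 M)], and
    Jacobi's formula turns it into [(c^2 det (1 - zM))' = 0].
    The same recursion bounds [c_m] geometrically; convergence of the
    multi-index series follows from [2 |<f, g>| <= <f, f> + <g, g>] applied to
    components, and closeness of the partial sums to 1 selects the branch. *)

(** * Power series of a determinant *)

Section Jacobi.
Variable R : comNzRingType.

Lemma deriv_big_prod (I : finType) (F : I -> {poly R}) :
  (\prod_i F i)^`() = \sum_i (F i)^`() * \prod_(j | j != i) F j.
Proof.
have gen (r : seq I) : uniq r -> (\prod_(i <- r) F i)^`() =
    \sum_(i <- r) (F i)^`() * \prod_(j <- r | j != i) F j.
  elim: r => [_|x r IH /= /andP[xr ur]]; first by rewrite !big_nil derivC.
  rewrite !big_cons derivM eqxx IH //=; congr (_ * _ + _).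
    rewrite big_seq_cond [RHS]big_seq_cond; apply: eq_bigl => j.
    by rewrite andbT; case: eqP => [->|]; rewrite ?(negbTE xr) ?andbT.
  rewrite mulr_sumr big_seq [RHS]big_seq; apply: eq_bigr => i ir.
  rewrite big_cons; case: eqP => [xi|_]; first by rewrite xi ir in xr.
  by rewrite mulrCA.
by rewrite gen ?index_enum_uniq.
Qed.

(** Jacobi's formula. Differentiating the Leibniz expansion gives one determinant per row, that of
    [Q i], in which only row [i] is differentiated; expanding it along that row produces the
    cofactors of [P]. *)
Lemma deriv_det (n : nat) (P : 'M[{poly R}]_n) :
  (\det P)^`() = \tr (\adj P *m map_mx (@deriv R) P).
Proof.
pose Q i := \matrix_(k, j) if k == i then (P k j)^`() else P k j.
have dQ i : \det (Q i) = \sum_j (P i j)^`() * cofactor P i j.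
  rewrite (expand_det_row _ i); apply: eq_bigr => j _.
  rewrite mxE eqxx /cofactor; congr (_ * (_ * \det _)).
  by apply/matrixP=> a b; rewrite !mxE eq_sym (negbTE (neq_lift _ _)).
transitivity (\sum_i \det (Q i)).
  rewrite /determinant raddf_sum exchange_big /=; apply: eq_bigr => s _.
  rewrite -mulr_sumr.
  have -> : ((-1) ^+ s * \prod_i P i (s i))^`() =
      (-1) ^+ s * (\prod_i P i (s i))^`().
    by case: (odd_perm s); rewrite ?expr0 ?expr1 ?mul1r ?mulN1r ?derivN.
  congr (_ * _); rewrite deriv_big_prod; apply: eq_bigr => i _.
  rewrite [RHS](bigD1 i) //= mxE eqxx; congr (_ * _).
  by apply: eq_bigr => j ji; rewrite mxE (negbTE ji).
transitivity (\sum_i \sum_j \adj P j i * map_mx (@deriv R) P i j).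
  by apply: eq_bigr => i _; rewrite dQ; apply: eq_bigr => j _; rewrite !mxE mulrC.
by rewrite exchange_big /=; apply: eq_bigr => j _; rewrite mxE.
Qed.

End Jacobi.

(** The recursion produces the product conj(T') S, while the final determinant has the factors in
    the opposite order; transposition exchanges symmetric factors. *)
Lemma det_1sub_mul_sym (R : comNzRingType) (n : nat) (A B : 'M[R]_n) :
  A^T = A -> B^T = B -> \det (1%:M - A *m B) = \det (1%:M - B *m A).
Proof.
by move=> symA symB; rewrite -det_tr linearB /= trmx1 trmx_mul symA symB.
Qed.

Section Series.
Variables (C : numFieldType) (d : nat) (M : 'M[C]_d).
Variables (c : nat -> C) (G : nat -> 'M[C]_d).
Hypothesis c0 : c 0%N = 1.
Hypothesis G0 : G 0%N = (c 0%N)%:M.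
Hypothesis GS : forall m, G m.+1 = (c m.+1)%:M + G m *m M.
Hypothesis cS : forall m, c m.+1 *+ (2 * m.+1) = \tr (G m *m M).

Definition detpoly : {poly C} := \det (1%:M - 'X *: map_mx polyC M).

Lemma detpoly1 : detpoly.[1] = \det (1%:M - M).
Proof.
rewrite -[_.[1]]/(horner_eval 1 _) -det_map_mx; congr (\det _).
apply/matrixP=> i j; rewrite !mxE; transitivity (((i == j)%:R - 'X * (M i j)%:P).[1]) => //.
by case: eqP => _; rewrite !hornerE.
Qed.

Lemma detpoly0 : detpoly.[0] = 1.
Proof.
rewrite -[_.[0]]/(horner_eval 0 _) -det_map_mx.
rewrite (_ : map_mx _ _ = 1%:M) ?det1 //.
apply/matrixP=> i j; rewrite !mxE; transitivity (((i == j)%:R - 'X * (M i j)%:P).[0]) => //.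
by case: eqP => _; rewrite !hornerE ?mul0r ?subr0 ?oppr0.
Qed.

(** Truncations of the generating series of [c] and [G]: identities of power series become
    polynomial identities with explicit errors divisible by a power of ['X]. *)
Let csum N : {poly C} := \poly_(i < N) c i.
Let Gsum N : 'M[{poly C}]_d := \sum_(i < N) 'X^i *: map_mx polyC (G i).
Let Mx : 'M[{poly C}]_d := map_mx polyC M.

(** The product telescopes by [GS]: in degree m > 0 only G_m - G_(m-1) M = c_m is left, up to the
    overflow in degree [N.+1]. *)
Lemma Gsum_mul N : Gsum N.+1 *m (1%:M - 'X *: Mx) =
  (csum N.+1)%:M - 'X^(N.+1) *: map_mx polyC (G N *m M).
Proof.
have mulX m (P : 'M[{poly C}]_d) :
    ('X^m *: P) *m (1%:M - 'X *: Mx) = 'X^m *: P - 'X^(m.+1) *: (P *m Mx).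
  by rewrite mulmxBr mulmx1 -scalemxAr -scalemxAl scalerA exprS.
elim: N => [|N IH].
  rewrite /Gsum /csum poly_def !big_ord1 mulX map_mxM G0 map_scalar_mx.
  by rewrite !expr0 scale1r alg_polyC.
rewrite /Gsum big_ord_recr /= -/(Gsum N.+1) mulmxDl IH mulX map_mxM.
have -> : csum N.+2 = csum N.+1 + c N.+1 *: 'X^(N.+1).
  by rewrite /csum !poly_def big_ord_recr.
rewrite raddfD /=.
rewrite {1}GS map_mxD map_scalar_mx -mul_polyC mulrC -scale_scalar_mx scalerDr.
rewrite !map_mxM /= !addrA; congr (_ + _).
by rewrite addrAC subrK.
Qed.

(** The derivative of the product is a multiple of ['X^N], so in characteristic 0 the coefficients
    of index 1 to [N] vanish; the constant one is read off at 0. *)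
Lemma csum_sqr_detpoly N j : (j <= N)%N ->
  (csum N.+1 ^+ 2 * detpoly)`_j = (j == 0%N)%:R.
Proof.
set cs := csum N.+1; set D := detpoly; set P := 1%:M - 'X *: Mx.
have dD : D^`() = - \tr (\adj P *m Mx).
  rewrite /D /detpoly deriv_det -/P -raddfN -mulmxN; congr (\tr (_ *m _)).
  apply/matrixP=> a b; rewrite !mxE derivB derivM derivX derivC.
  by case: eqP => _; rewrite ?derivC mulr0 mul1r addr0 sub0r.
(* By [cS] the derivative of [cs] involves only G_0, ..., G_(N-1); the last term of [Gsum N.+1] is
   the error. *)
have [Q2 cD] : exists Q, cs^`() *+ 2 = \tr (Gsum N.+1 *m Mx) - 'X^N * Q.
  exists (\tr (map_mx polyC (G N *m M))).
  rewrite /Gsum big_ord_recr /= mulmxDl -scalemxAl -map_mxM raddfD /= linearZ /=.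
  rewrite addrK /cs /csum poly_def big_ord_recl raddfD raddf_sum /=.
  rewrite derivZ derivC scaler0 add0r mulmx_suml raddf_sum /= -sumrMnl.
  apply: eq_bigr => i _; rewrite /bump add1n derivZ derivXn -scalemxAl linearZ /=.
  rewrite -map_mxM trace_map_mx -cS -!mul_polyC /= raddfMn /= !mulrnAr.
  by rewrite -mulrnA mulnC mulrC.
have [Q dvd] : exists Q, (cs ^+ 2 * D)^`() = 'X^N * Q.
  set E := map_mx polyC (G N *m M).
  (* This is [Gsum_mul] multiplied on the right by [\adj P], since [P *m \adj P] is the scalar
     matrix [D]. *)
  have GD : D *: Gsum N.+1 = cs *: \adj P - 'X^(N.+1) *: (E *m \adj P).
    rewrite -mul_mx_scalar -mul_mx_adj mulmxA Gsum_mul mulmxBl mul_scalar_mx.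
    by rewrite -scalemxAl.
  have tD : \tr (Gsum N.+1 *m Mx) * D =
      cs * \tr (\adj P *m Mx) - 'X^(N.+1) * \tr (E *m \adj P *m Mx).
    have -> : \tr (Gsum N.+1 *m Mx) * D = \tr (D *: Gsum N.+1 *m Mx).
      by rewrite -scalemxAl mxtraceZ mulrC.
    by rewrite GD mulmxBl raddfB /= -!scalemxAl !mxtraceZ.
  exists (- cs * (Q2 * D + 'X * \tr (E *m \adj P *m Mx))).
  have -> : (cs ^+ 2 * D)^`() = cs * ((cs^`() *+ 2) * D + cs * D^`()).
    by rewrite expr2 !derivM; ring.
  rewrite cD dD mulrBl tD exprS; ring.
case: j => [_|j jN].
  rewrite -horner_coef0 hornerM horner_exp detpoly0 mulr1 horner_coef0.
  by rewrite coef_poly /= c0 expr1n.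
have := congr1 (fun p : {poly C} => p`_j) dvd.
by rewrite coef_deriv coefXnM jN => /eqP; rewrite mulrn_eq0 /= => /eqP ->.
Qed.

(** Both bounds are proved in one induction. The trace of G_m M is a sum of d^2 products, which
    costs the factor d^2 a, and the growth m + 1 allowed for G_m is absorbed by the factor 2(m + 1)
    in [cS]. *)
Lemma series_bounds (a delta : C) : 0 <= a -> (d ^ 2)%:R * a <= delta ->
  (forall i j, `|M i j| <= a) ->
  forall m, `|c m| <= delta ^+ m /\ forall i j, `|G m i j| <= m.+1%:R * delta ^+ m.
Proof.
move=> a0 da Ma.
have delta0 : 0 <= delta by apply: le_trans da; rewrite mulr_ge0 ?ler0n.
elim=> [|m [IHc IHG]].
  rewrite c0 normr1 expr0; split=> // i j; rewrite G0 c0 mxE mulr1.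
  by case: eqP => _; rewrite ?mulr1n ?mulr0n ?normr1 ?normr0 ?ler01 ?lexx.
set g := m.+1%:R * delta ^+ m in IHG.
have g0 : 0 <= g by rewrite mulr_ge0 ?exprn_ge0 ?ler0n.
have GMa i j : `|(G m *m M) i j| <= g * (d%:R * a).
  rewrite mxE (le_trans (ler_norm_sum _ _ _)) //.
  apply: (@le_trans _ _ (\sum_(k < d) g * a)).
    by apply: ler_sum => k _; rewrite normrM ler_pM.
  by rewrite sumr_const card_ord mulrCA mulr_natl.
have trGM : `|\tr (G m *m M)| <= m.+1%:R * delta ^+ m.+1.
  apply: (@le_trans _ _ (\sum_(k < d) g * (d%:R * a))).
    by rewrite (le_trans (ler_norm_sum _ _ _)) // ler_sum.
  rewrite sumr_const card_ord -[_ *+ d]mulr_natl mulrCA (mulrA d%:R) -natrM mulnn.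
  by rewrite exprSr [leRHS]mulrA ler_wpM2l.
have cm : `|c m.+1| <= delta ^+ m.+1.
  have m0 : (0 : C) < m.+1%:R by rewrite ltr0n.
  rewrite -(ler_pM2l m0) (le_trans _ trGM) // -cS -[_ *+ (2 * _)]mulr_natl normrM normr_nat.
  by rewrite ler_wpM2r // ler_nat leq_pmull.
split=> // i j; rewrite GS mxE (le_trans (ler_normD _ _)) //.
rewrite -natr1 addrC mulrDl mul1r; apply: lerD; last first.
  by rewrite mxE; case: eqP; rewrite // normr0 exprn_ge0.
rewrite (le_trans (GMa i j)) // exprSr [leRHS]mulrA ler_wpM2l // (le_trans _ da) //.
(* The inequality d <= d^2 is all that remains. *)
by rewrite ler_wpM2r // ler_nat; case: (i) => k kd; nia.
Qed.

End Series.

(** * Coefficientwise majorants and the error at 1 *)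

Section Majorants.
Variable C : numFieldType.
Implicit Types P A : {poly C}.

Definition coef_le P A := forall i, `|P`_i| <= A`_i.

Lemma coef_leM P1 A1 P2 A2 :
  coef_le P1 A1 -> coef_le P2 A2 -> coef_le (P1 * P2) (A1 * A2).
Proof.
move=> le1 le2 i; rewrite !coefM (le_trans (ler_norm_sum _ _ _)) //.
by apply: ler_sum => j _; rewrite normrM ler_pM.
Qed.

Lemma coef_le_horner1 P A N : coef_le P A ->
  (forall j, (j <= N)%N -> P`_j = (j == 0%N)%:R) ->
  `|P.[1] - 1| <= A.[2] / 2 ^+ N.
Proof.
move=> PA PN; pose n := (maxn (size P) (size A)).+1.
rewrite (@horner_coef_wide _ n P) ?(@horner_coef_wide _ n A);
  try by rewrite /n; lia.
rewrite big_ord_recl PN //= expr0 mulr1 addrAC subrr add0r.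
rewrite mulr_suml [leRHS]big_ord_recl ler_wpDl //.
  by rewrite !mulr_ge0 ?invr_ge0 ?exprn_ge0 ?ler0n // (le_trans _ (PA _)).
rewrite (le_trans (ler_norm_sum _ _ _)) //; apply: ler_sum => i _.
rewrite expr1n mulr1; have [le_iN|lt_Ni] := leqP (bump 0 i) N.
  by rewrite PN // normr0 !mulr_ge0 ?invr_ge0 ?exprn_ge0 ?ler0n // (le_trans _ (PA _)).
rewrite -mulrA (le_trans (PA _)) // ler_peMr //; first by rewrite (le_trans _ (PA _)).
rewrite ler_pdivlMr ?exprn_gt0 ?ltr0n // mul1r ler_weXn2l ?ler1n //.
exact: ltnW.
Qed.

End Majorants.

Lemma geom_half_le (C : numFieldType) N : \sum_(i < N) (2^-1 : C) ^+ i <= 2.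
Proof.
have -> : \sum_(i < N) (2^-1 : C) ^+ i = 2 * (1 - 2^-1 ^+ N).
  elim: N => [|N IH]; first by rewrite big_ord0 expr0 subrr mulr0.
  by rewrite big_ord_recr /= IH exprS; field.
by rewrite ler_piMr ?ler0n // lerBlDr lerDl exprn_ge0 ?invr_ge0 ?ler0n.
Qed.

Lemma partial_sum_sqr_det (C : numFieldType) (d : nat) (M : 'M[C]_d)
    (c : nat -> C) (G : nat -> 'M[C]_d) :
  c 0%N = 1 -> G 0%N = (c 0%N)%:M ->
  (forall m, G m.+1 = (c m.+1)%:M + G m *m M) ->
  (forall m, c m.+1 *+ (2 * m.+1) = \tr (G m *m M)) ->
  (forall m, `|c m| <= 4^-1 ^+ m) ->
  exists K, 0 <= K /\ forall N,
    `|(\sum_(i < N.+1) c i) ^+ 2 * \det (1%:M - M) - 1| <= K / 2 ^+ N.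
Proof.
move=> c0 G0 GS cS cb; pose aD := map_poly Num.norm (detpoly M).
have aD_le : coef_le (detpoly M) aD.
  by move=> i; rewrite coef_map_id0 ?normr0.
have aD0 : 0 <= aD.[2].
  rewrite horner_coef sumr_ge0 // => i _.
  by rewrite mulr_ge0 ?exprn_ge0 ?ler0n // (le_trans _ (aD_le i)).
(* The majorant is the square of [g] below times [aD]. Since the ratio of [g] is 1/4, its value at 2
   is a partial geometric sum of ratio 1/2, at most 2; its square gives the 4. *)
exists (4 * aD.[2]); split=> [|N]; first by rewrite mulr_ge0 ?ler0n.
pose g : {poly C} := \poly_(i < N.+1) 4^-1 ^+ i.
have g_le : coef_le (\poly_(i < N.+1) c i) g.
  by move=> i; rewrite !coef_poly; case: ifP; rewrite ?normr0.
have := coef_le_horner1 (coef_leM (coef_leM g_le g_le) aD_le).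
rewrite -expr2 => /(_ N (fun j => csum_sqr_detpoly c0 G0 GS cS (N := N) (j := j))).
rewrite expr2 !hornerM detpoly1 -expr2.
have -> : (\poly_(i < N.+1) c i).[1] = \sum_(i < N.+1) c i.
  by rewrite horner_poly; apply: eq_bigr => i _; rewrite expr1n mulr1.
move/le_trans; apply; rewrite ler_wpM2r ?invr_ge0 ?exprn_ge0 ?ler0n //.
rewrite ler_wpM2r //.
have g2 : 0 <= g.[2] <= 2.
  have -> : g.[2] = \sum_(i < N.+1) 2^-1 ^+ i.
    rewrite horner_poly; apply: eq_bigr => i _; rewrite -exprMn; congr (_ ^+ _).
    by field.
  by rewrite geom_half_le sumr_ge0 // => i _; rewrite exprn_ge0 ?invr_ge0 ?ler0n.
have -> : 4 = 2 * 2 :> C by ring.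
by case/andP: g2 => *; rewrite ler_pM.
Qed.

(** * The Fischer inner product *)

Section Fischer.
Variables (R : rcfType) (n : nat).
Local Notation C := R[i].
Implicit Types f g h : {mpoly C[n]}.

Definition mfact (m : 'X_{1..n}) : C := (\prod_(k < n) (m k)`!)%:R.

(** The formula of [fischer] in any number of variables; for [n = l * 2] the two are convertible. *)
Definition fpair f g : C := \sum_(m <- msupp f) f@_m * Num.conj (g@_m) * mfact m.

Lemma fpair_wide (s : seq 'X_{1..n}) f g : uniq s -> {subset msupp f <= s} ->
  fpair f g = \sum_(m <- s) f@_m * Num.conj (g@_m) * mfact m.
Proof.
move=> us fs; rewrite [RHS](bigID (mem (msupp f))) /= [X in _ + X]big1 ?addr0.
  rewrite -big_filter; apply: perm_big; apply: uniq_perm; rewrite ?filter_uniq //.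
  by move=> m; rewrite mem_filter; case: (boolP (m \in msupp f)) => // /fs ->.
by move=> m /memN_msupp_eq0 ->; rewrite !mul0r.
Qed.

(** With an index set that depends only on the second argument, linearity in the first can be
    checked term by term. *)
Lemma fpair_wider (s : seq 'X_{1..n}) f g : uniq s -> {subset msupp g <= s} ->
  fpair f g = \sum_(m <- s) f@_m * Num.conj (g@_m) * mfact m.
Proof.
move=> us gs; pose s' := undup (s ++ msupp f).
rewrite (@fpair_wide s') ?undup_uniq //; last first.
  by move=> m mf; rewrite mem_undup mem_cat mf orbT.
rewrite (bigID (mem s)) /= [X in _ + X]big1 ?addr0.
  rewrite -big_filter; apply: perm_big; apply: uniq_perm; rewrite ?filter_uniq ?undup_uniq //.
  by move=> m; rewrite mem_filter mem_undup mem_cat; case: (m \in s).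
move=> m ms; rewrite (@memN_msupp_eq0 _ _ g) ?rmorph0 ?mulr0 ?mul0r //.
by apply: contra ms => /gs.
Qed.

Lemma fpairC f g : fpair g f = Num.conj (fpair f g).
Proof.
rewrite (@fpair_wider (msupp f)) ?msupp_uniq // rmorph_sum.
apply: eq_bigr => m _; by rewrite !rmorphM /= conjCK /mfact rmorph_nat [g@_m * _]mulrC.
Qed.

Lemma fpair_lin a f g h : fpair (a *: f + g) h = a * fpair f h + fpair g h.
Proof.
pose s := msupp h; have us : uniq s := msupp_uniq h.
rewrite !(@fpair_wider s) // mulr_sumr -big_split; apply: eq_bigr => m _ /=.
by rewrite mcoeffD mcoeffZ; ring.
Qed.

Lemma fpairDl f g h : fpair (f + g) h = fpair f h + fpair g h.
Proof. by rewrite -[f]scale1r fpair_lin mul1r scale1r. Qed.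

Lemma fpair0l h : fpair 0 h = 0.
Proof. by rewrite /fpair msupp0 big_nil. Qed.

Lemma fpairZl a f h : fpair (a *: f) h = a * fpair f h.
Proof. by rewrite -[_ *: _]addr0 fpair_lin fpair0l addr0. Qed.

Lemma fpairDr f g h : fpair h (f + g) = fpair h f + fpair h g.
Proof. by rewrite fpairC fpairDl rmorphD /= -!fpairC. Qed.

Lemma fpair0r h : fpair h 0 = 0.
Proof. by rewrite fpairC fpair0l rmorph0. Qed.

Lemma fpairZr a f h : fpair h (a *: f) = Num.conj a * fpair h f.
Proof. by rewrite fpairC fpairZl rmorphM /= -!fpairC. Qed.

Lemma fpair_suml (I : Type) (r : seq I) (P : pred I) F h :
  fpair (\sum_(i <- r | P i) F i) h = \sum_(i <- r | P i) fpair (F i) h.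
Proof. exact: (big_morph (fpair^~ h) (fun f g => fpairDl f g h) (fpair0l h)). Qed.

Lemma fpair_sumr (I : Type) (r : seq I) (P : pred I) F h :
  fpair h (\sum_(i <- r | P i) F i) = \sum_(i <- r | P i) fpair h (F i).
Proof. exact: (big_morph (fpair h) (fun f g => fpairDr f g h) (fpair0r h)). Qed.

Lemma fpairX m g : fpair 'X_[m] g = Num.conj (g@_m) * mfact m.
Proof. by rewrite /fpair msuppX big_seq1 mcoeffX eqxx mul1r. Qed.

Lemma fpair11 : fpair 1 1 = 1.
Proof.
rewrite -{1}mpolyX0 fpairX mcoeff1 eqxx rmorph1 mul1r /mfact big1 // => i _.
by rewrite mnm0E fact0.
Qed.

(** It suffices to take a monomial for [f]: the factor m_i + 1 produced by the derivative is the
    ratio of (m_i + 1)! to m_i!. *)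
Lemma fpair_mulX i f g : fpair ('X_i * f) g = fpair f g^`M(i).
Proof.
rewrite {1}[f]mpolyE mulr_sumr fpair_suml; apply: eq_bigr => m _.
rewrite -scalerAr -mpolyXD fpairZl fpairX mcoeff_deriv mulrA rmorphMn addmC.
rewrite -[_ *+ _]mulr_natr -!mulrA; congr (_ * (_ * _)).
rewrite /mfact -natrM (bigD1 i) //= [in RHS](bigD1 i) //=; congr (_%:R).
rewrite mnmDE mnm1E eqxx addn1 factS mulnA; congr (_ * _)%N.
apply: eq_bigr => j ji; rewrite mnmDE mnm1E eq_sym (negbTE ji) addn0 //.
Qed.

Lemma fpair_mulXr i f g : fpair f ('X_i * g) = fpair f^`M(i) g.
Proof. by rewrite fpairC fpair_mulX -fpairC. Qed.

Lemma fpair_ge0 f : 0 <= fpair f f.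
Proof.
by apply: sumr_ge0 => m _; rewrite -normCK mulr_ge0 ?exprn_ge0 ?ler0n.
Qed.

(** This serves in place of the Cauchy-Schwarz inequality: the right side is additive over
    orthogonal components, so the bound can be summed over multidegrees. *)
Lemma fpair_amgm f g : `|fpair f g| <= 2^-1 * (fpair f f + fpair g g).
Proof.
pose s := undup (msupp f ++ msupp g); have us : uniq s := undup_uniq _.
have fs : {subset msupp f <= s} by move=> m; rewrite mem_undup mem_cat => ->.
have gs : {subset msupp g <= s} by move=> m; rewrite mem_undup mem_cat orbC => ->.
rewrite (fpair_wide _ us fs) (fpair_wide f us fs) (fpair_wide g us gs).
rewrite -big_split mulr_sumr (le_trans (ler_norm_sum _ _ _)) //.
apply: ler_sum => m _ /=; rewrite -!normCK -mulrDl mulrA normrM normr_nat.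
rewrite ler_wpM2r ?ler0n // normrM norm_conjC.
rewrite -subr_ge0 -[leRHS](_ : 2^-1 * (`|f@_m| - `|g@_m|) ^+ 2 = _).
  by rewrite mulr_ge0 ?invr_ge0 ?ler0n // real_exprn_even_ge0 // realB ?normr_real.
by field.
Qed.

End Fischer.

(** * Quadratic forms and the recursion for their divided powers *)

Lemma sym_mxE (C : Type) (d : nat) (S : 'M[C]_d) i j : S^T = S -> S i j = S j i.
Proof. by move=> {1}<-; rewrite mxE. Qed.

Section GaussianRecursion.
Variables (R : rcfType) (n d : nat) (phi : 'I_d -> 'I_n).
Hypothesis phi_inj : injective phi.
Local Notation C := R[i].
Implicit Types (q : {mpoly C[n]}) (S T : 'M[C]_d).

Definition divpow q m : {mpoly C[n]} := (m`!%:R^-1 : C) *: q ^+ m.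

(** The injection [phi] names the variable attached to each matrix index, because block matrices and
    polynomial variables are indexed by different types. *)
Definition quad S : {mpoly C[n]} :=
  2^-1 *: \sum_i \sum_j S i j *: ('X_(phi i) * 'X_(phi j)).

Definition linform T j : {mpoly C[n]} := \sum_k T j k *: 'X_(phi k).

Lemma factC_neq0 m : (m`!%:R : C) != 0.
Proof. by rewrite pnatr_eq0 -lt0n fact_gt0. Qed.

Lemma divpowS q m : q * divpow q m = m.+1%:R *: divpow q m.+1.
Proof.
rewrite /divpow -scalerAr -exprS scalerA; congr (_ *: _).
by rewrite factS natrM invfM mulrA divff ?mul1r // pnatr_eq0.
Qed.

Lemma divpow0 q : divpow q 0 = 1.
Proof. by rewrite /divpow expr0 fact0 invr1 scale1r. Qed.

Lemma mderiv_divpow0 q i : (divpow q 0)^`M(i) = 0.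
Proof. by rewrite divpow0 -mpolyC1 mderivC. Qed.

Lemma mderiv_divpowS q i m : (divpow q m.+1)^`M(i) = q^`M(i) * divpow q m.
Proof.
have dX k : (q ^+ k.+1)^`M(i) = (q^`M(i) * q ^+ k) *+ k.+1.
  elim: k => [|k IH]; first by rewrite expr1 expr0 mulr1.
  by rewrite exprS mderivM IH mulrnAr mulrCA -exprS -mulrS.
rewrite /divpow mderivZ dX -scalerAr -[(_ * _) *+ _]scaler_nat scalerA; congr (_ *: _).
by rewrite factS natrM invfM mulrAC mulVf ?mul1r // pnatr_eq0.
Qed.

Lemma mderivXU (i j : 'I_n) : ('X_j : {mpoly C[n]})^`M(i) = (i == j)%:R.
Proof.
rewrite mderivX mnm1E eq_sym; case: eqP => [->|_]; last by rewrite scale0r.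
rewrite scale1r -mpolyX0; congr 'X_[_]; apply/mnmP => k.
by rewrite mnmBE mnm0E subnn.
Qed.

Lemma mderiv_quad S j : S^T = S -> (quad S)^`M(phi j) = linform S j.
Proof.
move=> symS.
have lin : linform S j = \sum_i S i j *: 'X_(phi i).
  by apply: eq_bigr => i _; rewrite sym_mxE.
rewrite /quad mderivZ (raddf_sum (mderiv (phi j))) /=.
transitivity (2^-1 *: (linform S j + linform S j)); last first.
  by rewrite -mulr2n -[linform _ _ *+ _]scaler_nat scalerA mulVf ?pnatr_eq0 // scale1r.
congr (_ *: _); rewrite {2}lin.
transitivity (\sum_i \sum_k ((i == j)%:R * S i k *: 'X_(phi k) +
     (k == j)%:R * S i k *: 'X_(phi i))).
  apply: eq_bigr => i _; rewrite (raddf_sum (mderiv (phi j))) /=; apply: eq_bigr => k _.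
  rewrite mderivZ mderivM !mderivXU !(inj_eq phi_inj) scalerDr.
  rewrite -!scalerA ![j == _]eq_sym !scaler_nat !scalerMnr !mulr_natl mulr_natr.
  by [].
under eq_bigr do rewrite big_split /=.
rewrite big_split /=; congr (_ + _).
  rewrite (bigD1 j) //= [X in _ + X]big1 ?addr0 => [|i ij].
    by apply: eq_bigr => k _; rewrite eqxx mul1r.
  by apply: big1 => k _; rewrite (negbTE ij) mul0r scale0r.
apply: eq_bigr => i _; rewrite (bigD1 j) //= [X in _ + X]big1 ?addr0 => [|k kj].
  by rewrite eqxx mul1r.
by rewrite (negbTE kj) mul0r scale0r.
Qed.

Variables S T : 'M[C]_d.
Hypotheses (symS : S^T = S) (symT : T^T = T).
Let B : 'M[C]_d := map_mx Num.conj T.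
Let p m := divpow (quad S) m.
Let r m := divpow (quad T) m.

Definition gcoef m : C := fpair (p m) (r m).
Definition gmat m : 'M[C]_d :=
  \matrix_(i, j) fpair ('X_(phi i) * p m) ('X_(phi j) * r m).

Lemma gcoef0 : gcoef 0 = 1.
Proof. by rewrite /gcoef /p /r !divpow0 fpair11. Qed.

(** Moving ['X_(phi i)] to the other side as a derivative and applying the product rule to
    ['X_(phi j) * r m] yields a scalar part and a remainder. *)
Lemma gmatE m : gmat m = (gcoef m)%:M + \matrix_(i, j)
  fpair (p m) ('X_(phi j) * (r m)^`M(phi i)).
Proof.
apply/matrixP=> i j; rewrite !mxE fpair_mulX mderivM fpairDr mderivXU.
rewrite (inj_eq phi_inj) /gcoef; case: eqP => _; first by rewrite mul1r mulr1n.
by rewrite mul0r fpair0r mulr0n.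
Qed.

Lemma gmat0 : gmat 0 = (gcoef 0)%:M.
Proof.
rewrite gmatE -[RHS]addr0; congr (_ + _); apply/matrixP=> i j.
by rewrite !mxE mderiv_divpow0 mulr0 fpair0r.
Qed.

(** Contracting with [B] turns the variable next to [r m] into the linear form that is a derivative
    of [r m.+1]. The resulting expression is symmetric in [i] and [j], as needed in [gmatS]. *)
Lemma gmatB m i j : (gmat m *m B) i j =
  fpair ('X_(phi i) * ('X_(phi j) * p m)) (r m.+1).
Proof.
rewrite mulrCA fpair_mulX mderiv_divpowS mderiv_quad // /linform mulr_suml.
rewrite fpair_sumr mxE; apply: eq_bigr => k _.
by rewrite -scalerAl fpairZr !mxE mulrC (sym_mxE k j symT).
Qed.

(** The remainder in [gmatE] pairs a derivative of [p m.+1] with one of [r m.+1], so it is the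
    transpose of [S *m gmat m *m B]; symmetry of [gmat m *m B] restores the stated order. *)
Lemma gmatS m : gmat m.+1 = (gcoef m.+1)%:M + gmat m *m (B *m S).
Proof.
rewrite gmatE; congr (_ + _); apply/matrixP=> i j.
have symGB : (gmat m *m B)^T = gmat m *m B.
  by apply/matrixP=> a b; rewrite mxE !gmatB mulrCA.
have -> : gmat m *m (B *m S) = (S *m gmat m *m B)^T.
  by rewrite -mulmxA trmx_mul symGB symS mulmxA.
rewrite 2!mxE fpair_mulXr !mderiv_divpowS !mderiv_quad // /linform !mulr_suml.
rewrite fpair_sumr mxE; apply: eq_bigr => k _.
rewrite -scalerAl fpairZr fpair_suml !mxE mulrC (sym_mxE k i symT); congr (_ * _).
by apply: eq_bigr => l _; rewrite -scalerAl fpairZl !mxE.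
Qed.

(** Write (m + 1) p_(m+1) as [quad S * p m]; expanding the quadratic form and using [gmatB] gives
    the trace. *)
Lemma gcoefS m : gcoef m.+1 *+ (2 * m.+1) = \tr (gmat m *m (B *m S)).
Proof.
rewrite mulmxA mulrnA; transitivity (fpair (2 *: (quad S * p m)) (r m.+1)).
  by rewrite divpowS 2!fpairZl !mulr_natl mulrnAC.
rewrite /quad -scalerAl scalerA divff ?pnatr_eq0 // scale1r mulr_suml fpair_suml.
apply: eq_bigr => i _; rewrite mulr_suml fpair_suml mxE; apply: eq_bigr => j _.
by rewrite gmatB -scalerAl fpairZl mulrC mulrA (sym_mxE j i symS).
Qed.

Lemma gcoef_bound (a b : C) : 0 <= a -> 0 <= b -> 
  (forall i j, `|S i j| <= a) -> (forall i j, `|T i j| <= b) ->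
  (d ^ 3)%:R * (a * b) <= 4^-1 -> forall m, `|gcoef m| <= 4^-1 ^+ m.
Proof.
move=> a0 b0 Sa Tb dab m.
have [||i j|+ _] := series_bounds gcoef0 gmat0 gmatS gcoefS
   (* Each entry of [B *m S] is a sum of [d] products bounded by [a * b]; with the d^2 of
      [series_bounds] this makes d^3. *)
   (a := d%:R * (a * b)) (delta := 4^-1) _ _ _ m.
- by rewrite !mulr_ge0.
- by rewrite (mulrA (d ^ 2)%:R) -natrM -expnSr.
- rewrite mxE (le_trans (ler_norm_sum _ _ _)) //.
  apply: (@le_trans _ _ (\sum_(k < d) a * b)).
    by apply: ler_sum => k _; rewrite normrM mulrC ler_pM // mxE norm_conjC.
  by rewrite sumr_const card_ord mulr_natl.
by [].
Qed.

End GaussianRecursion.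

(** * Multidegrees *)

Section Multinomial.
Variables (R : rcfType) (n : nat).
Local Notation C := R[i].
Local Notation poly_n := {mpoly C[n]}.

Lemma divpowD (x y : poly_n) m :
  divpow (x + y) m = \sum_(i < m.+1) divpow x i * divpow y (m - i).
Proof.
rewrite /divpow addrC exprDn scaler_sumr; apply: eq_bigr => i _.
rewrite -scalerAl -scalerAr scalerA [x ^+ _ * _]mulrC -[(_ * _) *+ _]scaler_nat scalerA.
congr (_ *: _).
  have im : (i <= m)%N by rewrite -ltnS.
  have := congr1 (fun k => k%:R : C) (bin_fact im); rewrite !natrM => <-.
  by field; rewrite !factC_neq0 pnatr_eq0 -lt0n bin_gt0 im.
Qed.

Lemma divpow0x m : divpow (0 : poly_n) m = (m == 0%N)%:R.
Proof.
case: m => [|m]; first by rewrite divpow0.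
by rewrite /divpow expr0n scaler0.
Qed.

(** For divided powers the multinomial theorem has all coefficients 1. It is read off the product of
    the truncated exponentials [E i], whose truncation at [K] does not affect the coefficient of
    index [m]. *)
Lemma divpow_prod (I : finType) (x : I -> poly_n) K m : (m < K)%N ->
  divpow (\sum_i x i) m =
  \sum_(f : {ffun I -> 'I_K} | (\sum_i f i)%N == m) \prod_i divpow (x i) (f i).
Proof.
move=> mK; pose E i : {poly poly_n} := \sum_(k < K) divpow (x i) k *: 'X^k.
have coefE i k : (k < K)%N -> (E i)`_k = divpow (x i) k.
  by move=> kK; rewrite /E -(poly_def K (divpow (x i))) coef_poly kK.
have coef_prodE k : (k < K)%N ->
    (\prod_i E i)`_k = divpow (\sum_i x i) k.
  elim: (index_enum I) k => [|i s IH] k kK.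
    by rewrite !big_nil coef1 divpow0x.
  rewrite !big_cons coefM divpowD; apply: eq_bigr => j _.
  by rewrite coefE ?IH // (leq_ltn_trans _ kK) ?leq_subr // -ltnS.
rewrite -coef_prodE // /E bigA_distr_bigA coef_sum /= [RHS]big_mkcond.
apply: eq_bigr => f _; rewrite scaler_prod.
have -> : \prod_i 'X^(f i) = 'X^(\sum_i f i) :> {poly poly_n}.
  by rewrite (big_morph _ (exprD 'X) (expr0 'X)).
by rewrite coefZ coefXn eq_sym; case: eqP; rewrite ?mulr1 ?mulr0.
Qed.

End Multinomial.

Section Grading.
Variables (R : rcfType) (n l : nat) (gr : 'I_n -> 'I_l).
Local Notation C := R[i].
Implicit Types (f g : {mpoly C[n]}) (a b : {ffun 'I_l -> nat}).

Definition mgrade (m : 'X_{1..n}) : {ffun 'I_l -> nat} :=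
  [ffun j => \sum_(k < n | gr k == j) m k]%N.

Lemma mgradeD m1 m2 : mgrade (m1 + m2) = mgrade m1 + mgrade m2.
Proof.
apply/ffunP=> j; rewrite !ffunE -big_split; apply: eq_bigr => k _.
exact: mnmDE.
Qed.

Lemma mgrade0 : mgrade 0 = 0.
Proof. by apply/ffunP=> j; rewrite !ffunE big1 // => k _; rewrite mnm0E. Qed.

Lemma mgradeU k : mgrade U_(k) = [ffun j => nat_of_bool (gr k == j)].
Proof.
apply/ffunP=> j; rewrite !ffunE big_mkcond (bigD1 k) //= mnm1E eqxx.
rewrite big1 ?addn0 => [|i ik]; first by case: eqP.
by rewrite mnm1E [k == i]eq_sym (negbTE ik) if_same.
Qed.

Lemma sum_mgrade m : (\sum_j mgrade m j)%N = mdeg m.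
Proof.
rewrite mdegE (partition_big gr xpredT) //=; apply: eq_bigr => j _.
by rewrite ffunE.
Qed.

Definition multihomog a f := forall m, m \in msupp f -> mgrade m = a.

Lemma multihomogX k :
  multihomog [ffun j => nat_of_bool (gr k == j)] ('X_k : {mpoly C[n]}).
Proof. by move=> m; rewrite msuppX inE => /eqP ->; rewrite mgradeU. Qed.

Lemma multihomog1 : multihomog 0 (1 : {mpoly C[n]}).
Proof. by move=> m; rewrite msupp1 inE => /eqP ->; rewrite mgrade0. Qed.

Lemma multihomogM a b f g :
  multihomog a f -> multihomog b g -> multihomog (a + b) (f * g).
Proof.
move=> fa gb m /msuppM_le /allpairsP[[m1 m2] /= [/fa <- /gb <- ->]].
exact: mgradeD.
Qed.

Lemma multihomogZ a c f : multihomog a f -> multihomog a (c *: f).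
Proof. by move=> fa m /msuppZ_le /fa. Qed.

Lemma multihomogD a f g :
  multihomog a f -> multihomog a g -> multihomog a (f + g).
Proof. by move=> fa ga m /msuppD_le; rewrite mem_cat => /orP[/fa|/ga]. Qed.

Lemma multihomog_sum a (I : finType) (P : pred I) (F : I -> {mpoly C[n]}) :
  (forall i, P i -> multihomog a (F i)) -> multihomog a (\sum_(i | P i) F i).
Proof.
move=> Fa; elim/big_ind: _ => //; last exact: multihomogD.
by move=> m; rewrite msupp0.
Qed.

Lemma multihomog_divpow a f k :
  multihomog a f -> multihomog (a *+ k) (divpow f k).
Proof.
move=> fa; apply: multihomogZ; elim: k => [|k IH]; first exact: multihomog1.
by rewrite exprS mulrS; apply: multihomogM.
Qed.

Lemma multihomog_prod (I : finType) (P : pred I) (A : I -> {ffun 'I_l -> nat})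
    (F : I -> {mpoly C[n]}) :
  (forall i, P i -> multihomog (A i) (F i)) ->
  multihomog (\sum_(i | P i) A i) (\prod_(i | P i) F i).
Proof.
move=> FA; elim/big_ind2: _ => //; first exact: multihomog1.
by move=> x1 x2 y1 y2; apply: multihomogM.
Qed.

Definition proj a f : {mpoly C[n]} :=
  \sum_(m <- msupp f | mgrade m == a) f@_m *: 'X_[m].

Lemma mcoeff_proj a f m : (proj a f)@_m = f@_m *+ (mgrade m == a).
Proof.
rewrite [in RHS](mpolyE f) !raddf_sum -sumrMnl /proj big_mkcond /=.
apply: eq_bigr => k _; rewrite mcoeffZ mcoeffX.
have [<-|/negbTE km] := eqVneq k m.
  by case: eqP => _; rewrite ?mulr1n ?mulr0n ?mcoeffZ ?mcoeffX ?eqxx ?mcoeff0.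
by case: eqP; rewrite ?mcoeffZ ?mcoeffX ?km ?mulr0 ?mul0rn ?mcoeff0.
Qed.

Lemma proj_sum a (I : finType) (P : pred I) (F : I -> {mpoly C[n]}) :
  proj a (\sum_(i | P i) F i) = \sum_(i | P i) proj a (F i).
Proof.
apply/mpolyP => m; rewrite mcoeff_proj !raddf_sum -sumrMnl.
by apply: eq_bigr => i _ /=; rewrite mcoeff_proj.
Qed.

Lemma proj_multihomog a b f : multihomog a f -> proj b f = f *+ (a == b).
Proof.
move=> fa; apply/mpolyP => m; rewrite mcoeff_proj mcoeffMn.
have [mf|/memN_msupp_eq0 ->] := boolP (m \in msupp f); last by rewrite !mul0rn.
by rewrite (fa _ mf).
Qed.

Lemma proj_dhomog k a f : f \is k.-homog -> (\sum_j a j)%N != k -> proj a f = 0.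
Proof.
move=> /dhomogP fk ak; apply/mpolyP => m; rewrite mcoeff_proj mcoeff0.
have [mf|/memN_msupp_eq0 ->] := boolP (m \in msupp f); last by rewrite mul0rn.
case: eqP => // ma; move: ak; rewrite -ma sum_mgrade.
by move/(_ _ mf): fk => /= ->; rewrite eqxx.
Qed.

Lemma fpair_proj a f g : fpair (proj a f) (proj a g) =
  \sum_(m <- msupp f) f@_m * Num.conj (g@_m) * mfact R m *+ (mgrade m == a).
Proof.
have pf : {subset msupp (proj a f) <= msupp f}.
  move=> m; rewrite !mcoeff_msupp mcoeff_proj; apply: contra => /eqP ->.
  by rewrite mul0rn.
rewrite (fpair_wide _ _ pf) ?msupp_uniq //; apply: eq_bigr => m _.
by rewrite !mcoeff_proj; case: eqP; rewrite ?mulr1n ?mul0r.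
Qed.

Definition inbox N (k : {ffun 'I_l -> 'I_N}) : {ffun 'I_l -> nat} :=
  [ffun j => val (k j)].

(** A multidegree inside the box is [inbox k] for exactly one [k], so summing projections over a box
    amounts to an indicator on monomials. *)
Lemma sum_inbox N a :
  (\sum_(k : {ffun 'I_l -> 'I_N}) (a == inbox k))%N = [forall j, a j < N]%N :> nat.
Proof.
case: forallP => [aN|aN]; last first.
  apply: big1 => k _; case: eqP => // ak; case: aN => j.
  by rewrite ak ffunE /=; exact: ltn_ord.
pose k0 : {ffun 'I_l -> 'I_N} := [ffun j => Ordinal (aN j)].
have ak0 : a = inbox k0 by apply/ffunP=> j; rewrite !ffunE.
rewrite (bigD1 k0) //= -ak0 eqxx big1 ?addn0 // => k kk0.
case: eqP => // ak; case/eqP: kk0; apply/ffunP => j; apply: val_inj.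
by rewrite ffunE /= ak ffunE.
Qed.

Lemma sum_fpair_proj N f g :
  \sum_(k : {ffun 'I_l -> 'I_N}) fpair (proj (inbox k) f) (proj (inbox k) g) =
  \sum_(m <- msupp f)
     f@_m * Num.conj (g@_m) * mfact R m *+ [forall j, mgrade m j < N]%N.
Proof.
under eq_bigr do rewrite fpair_proj.
rewrite exchange_big /=; apply: eq_bigr => m _.
by rewrite -sum_inbox -sumrMnr.
Qed.

(** Bessel's inequality for the orthogonal multihomogeneous components: monomials outside the box
    contribute nonnegative terms to [fpair f f]. *)
Lemma sum_fpair_proj_le N f :
  \sum_(k : {ffun 'I_l -> 'I_N}) fpair (proj (inbox k) f) (proj (inbox k) f)
  <= fpair f f.
Proof.
rewrite sum_fpair_proj; apply: ler_sum => m _; case: [forall _, _] => //.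
by rewrite mulr0n -normCK mulr_ge0 ?exprn_ge0 ?ler0n.
Qed.

Lemma sum_fpair_proj_eq N k f g : f \is k.-homog -> (k < N)%N ->
  \sum_(b : {ffun 'I_l -> 'I_N}) fpair (proj (inbox b) f) (proj (inbox b) g) =
  fpair f g.
Proof.
move=> /dhomogP fk kN; rewrite sum_fpair_proj /fpair big_seq [RHS]big_seq.
apply: eq_bigr => m mf; rewrite (_ : [forall _, _] = true) //.
apply/forallP => j; apply: leq_ltn_trans kN; rewrite -(fk _ mf) /= -sum_mgrade.
by rewrite (bigD1 j) //= leq_addr.
Qed.

End Grading.

(** * Sums over admissible matrices as multihomogeneous components *)

Section Components.
Variables (R : rcfType) (n l : nat) (gr : 'I_n -> 'I_l).
Local Notation C := R[i].
Variable x : 'I_l -> 'I_l -> {mpoly C[n]}.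

Definition edeg (i : 'I_l) : {ffun 'I_l -> nat} := [ffun j => nat_of_bool (i == j)].

Hypothesis x_hom : forall i j : 'I_l, (i < j)%N -> multihomog gr (edeg i + edeg j) (x i j).

Definition xsum := \sum_(i < l) \sum_(j < l | (i < j)%N) x i j.

Definition xprod (alpha : 'M[nat]_l) :=
  \prod_(i < l) \prod_(j < l | (i < j)%N) divpow (x i j) (alpha i j).

Definition component (a : {ffun 'I_l -> nat}) : {mpoly C[n]} :=
  \sum_(alpha : 'M['I_(\sum_i a i).+1]_l | admissible a (map_mx val alpha))
    xprod (map_mx val alpha).

(** Extending [x] by zero to all pairs makes the multinomial theorem apply over a full finite type;
    exponent functions that are not [upper] then give zero products. *)
Let y (p : 'I_l * 'I_l) := if (p.1 < p.2)%N then x p.1 p.2 else 0.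

Let upper K (f : {ffun 'I_l * 'I_l -> 'I_K}) :=
  [forall p : 'I_l * 'I_l, (p.1 < p.2)%N || (f p == 0%N :> nat)].

Let rowdeg K (f : {ffun 'I_l * 'I_l -> 'I_K}) : {ffun 'I_l -> nat} :=
  \sum_(p : 'I_l * 'I_l) (edeg p.1 + edeg p.2) *+ f p.

(** Handshake count: each pair contributes its exponent to both of its ends. *)
Let sum_rowdeg K (f : {ffun 'I_l * 'I_l -> 'I_K}) :
  (\sum_i rowdeg f i)%N = (\sum_p f p).*2.
Proof.
rewrite /rowdeg; under eq_bigr do rewrite sum_ffunE.
rewrite exchange_big /= -mul2n big_distrr /=; apply: eq_bigr => p _.
have sum_edeg i : (\sum_j edeg i j)%N = 1%N.
  rewrite (bigD1 i) //= ffunE eqxx big1 ?addn0 // => j ji.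
  by rewrite ffunE eq_sym (negbTE ji).
transitivity (\sum_i (edeg p.1 i + edeg p.2 i) * f p)%N.
  by apply: eq_bigr => i _; rewrite ffunMnE -mulr_natr natn !ffunE.
by rewrite -big_distrl /= big_split /= !sum_edeg.
Qed.

Let xsumE : xsum = \sum_p y p.
Proof.
rewrite /xsum; under eq_bigr do rewrite big_mkcond.
by rewrite pair_bigA.
Qed.

Let prod_y_hom K (f : {ffun 'I_l * 'I_l -> 'I_K}) : upper f ->
  multihomog gr (rowdeg f) (\prod_p divpow (y p) (f p)).
Proof.
move=> /forallP uf; apply: multihomog_prod => p _.
have := uf p; rewrite /y; case: ifP => [pp _|_ /= /eqP ->].
  exact/multihomog_divpow/x_hom.
by rewrite divpow0 mulr0n; apply: multihomog1.
Qed.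

Let prod_y0 K (f : {ffun 'I_l * 'I_l -> 'I_K}) : ~~ upper f ->
  \prod_p divpow (y p) (f p) = 0.
Proof.
rewrite negb_forall => /existsP[p]; rewrite negb_or => /andP[np fp].
by rewrite (bigD1 p) //= /y (negbTE np) divpow0x (negbTE fp) mul0r.
Qed.

(** A symmetric matrix with zero diagonal is determined by its strict upper triangle; [sym] and
    [upp] are the two directions of this correspondence, which carries row sums to [rowdeg]. *)
Let component_ffun (a : {ffun 'I_l -> nat}) : component a =
  \sum_(f : {ffun 'I_l * 'I_l -> 'I_(\sum_i a i).+1} | upper f && (rowdeg f == a))
     \prod_p divpow (y p) (f p).
Proof.
set K := (\sum_i a i)%N.
pose sym (f : {ffun 'I_l * 'I_l -> 'I_K.+1}) : 'M['I_K.+1]_l := \matrix_(i, j)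
  if (i < j)%N then f (i, j) else if (j < i)%N then f (j, i) else ord0.
pose upp (al : 'M['I_K.+1]_l) : {ffun 'I_l * 'I_l -> 'I_K.+1} :=
  [ffun p : 'I_l * 'I_l => if (p.1 < p.2)%N then al p.1 p.2 else ord0].
rewrite /component (reindex_onto sym upp) => [|al]; last first.
  case/andP=> /andP[/forallP al0 /forallP als] _; apply/matrixP=> i j.
  have := al0 i; have /forallP/(_ j) := als i; rewrite !mxE !ffunE /=.
  move=> /eqP/val_inj aij /eqP aii.
  case: ltngtP => // ij; apply: val_inj => /=.
  by rewrite -(val_inj ij) aii.
have uppsym f : (upp (sym f) == f) = upper f.
  apply/eqP/forallP => [<- p|uf]; first by rewrite !ffunE; case: (ltnP p.1 p.2).
  apply/ffunP=> -[i j]; have := uf (i, j); rewrite !ffunE !mxE /=.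
  by case: ltnP => //= _ /eqP fij; apply: val_inj.
apply: eq_big => [f|f /andP[_]].
  rewrite uppsym andbC; have [uf|//] := boolP (upper f); rewrite /= /admissible.
  have -> : [forall i, map_mx val (sym f) i i == 0%N].
    by apply/forallP => i; rewrite !mxE ltnn.
  have -> : [forall i, forall j, map_mx val (sym f) i j == map_mx val (sym f) j i].
    by apply/forallP => i; apply/forallP => j; rewrite !mxE; case: ltngtP.
  have rowE i : (\sum_(j < l) map_mx val (sym f) i j)%N = rowdeg f i.
    rewrite /rowdeg sum_ffunE.
    have -> : (\sum_(p : 'I_l * 'I_l) ((edeg p.1 + edeg p.2) *+ f p) i)%N =
        (\sum_(j < l) \sum_(k < l) ((j == i) + (k == i)) * f (j, k))%N.
      by rewrite pair_bigA; apply: eq_bigr => -[j k] _; rewrite ffunMnE -mulr_natr natn !ffunE.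
    have f0 (j k : 'I_l) : ~~ (j < k)%N -> f (j, k) = 0%N :> nat.
      by move=> njk; have /forallP/(_ (j, k)) := uf; rewrite (negbTE njk) => /eqP.
    transitivity (\sum_j f (i, j) + \sum_j f (j, i))%N.
      rewrite -big_split; apply: eq_bigr => j _; rewrite !mxE /=.
      case: (ltngtP i j) => ij.
      - by rewrite (f0 j i) ?addn0 // -leqNgt ltnW.
      - by rewrite (f0 i j) // -leqNgt ltnW.
      - by rewrite (f0 i j) ?(f0 j i) // ij ltnn.
    under [RHS]eq_bigr do
      (under eq_bigr do rewrite mulnDl; rewrite big_split /=).
    rewrite big_split /=; congr (_ + _)%N.
      rewrite [RHS](bigD1 i) //= [X in (_ + X)%N]big1 ?addn0 => [|j ji].
        by apply: eq_bigr => j _; rewrite eqxx mul1n.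
      by rewrite big1 // => k _; rewrite (negbTE ji).
    apply: eq_bigr => j _; rewrite [RHS](bigD1 i) //= eqxx mul1n.
    by rewrite big1 ?addn0 // => k /negbTE ->.
  apply/forallP/eqP => [ra|fa i]; last by rewrite rowE fa.
  by apply/ffunP => i; rewrite -rowE; apply/eqP.
rewrite uppsym => /forallP uf; rewrite /xprod.
transitivity (\prod_(i < l) \prod_(j < l)
    if (i < j)%N then divpow (x i j) (sym f i j) else 1).
  apply: eq_bigr => i _; rewrite big_mkcond; apply: eq_bigr => j _.
  by rewrite mxE.
rewrite pair_bigA; apply: eq_bigr => -[i j] _.
rewrite /y /= !mxE; have := uf (i, j) => /=.
by case: ltnP => //= _ /eqP ->; rewrite divpow0.
Qed.

Lemma component_even (a : {ffun 'I_l -> nat}) m :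
  (\sum_i a i)%N = m.*2 -> component a = proj gr a (divpow xsum m).
Proof.
move=> am; rewrite xsumE (@divpow_prod _ _ _ _ (\sum_i a i).+1); last first.
  by rewrite am ltnS -addnn leq_addr.
rewrite component_ffun proj_sum.
rewrite [LHS]big_mkcond [RHS]big_mkcond /=; apply: eq_bigr => f _.
have [uf|nuf] := boolP (upper f); last first.
  rewrite prod_y0 //= /proj msupp0 big_nil; by case: ifP.
rewrite (proj_multihomog _ (prod_y_hom uf)) /=.
case: (eqVneq (rowdeg f) a) => [fa|_]; last by rewrite mulr0n if_same.
(* Fixing the row degrees forces the total exponent [m] required by the multinomial sum. *)
have : (\sum_p f p).*2 = m.*2 by rewrite -sum_rowdeg fa am.
by move/double_inj => ->; rewrite eqxx.
Qed.

Lemma component_odd (a : {ffun 'I_l -> nat}) : odd (\sum_i a i)%N -> component a = 0.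
Proof.
move=> oa; rewrite component_ffun; apply: big1 => f /andP[_ /eqP fa].
have ha : (\sum_i a i)%N = (\sum_p f p).*2 by rewrite -sum_rowdeg fa.
by exfalso; move: oa; rewrite ha odd_double.
Qed.

End Components.

(** * Block matrices *)

Section BlockForm.
Variables (R : rcfType) (l : nat).
Local Notation C := R[i].
Local Notation poly_l := {mpoly C[l * 2]}.
Local Notation N2 := (\sum_(i < l) 2)%N.
Local Notation bk := (@tagnat.sig1 l (fun=> 2%N)).
Local Notation pos := (@tagnat.sig2 l (fun=> 2%N)).

Lemma sum_blocks (V : nmodType) (F : 'I_l -> 'I_2 -> V) :
  \sum_(s < N2) F (bk s) (pos s) = \sum_(i < l) \sum_(c < 2) F i c.
Proof.
pose F' (t : {i : 'I_l & 'I_2}) := F (tag t) (tagged t).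
transitivity (\sum_t F' t); last first.
  by rewrite (sig_big_dep xpredT (fun=> xpredT) F).
rewrite (reindex (@tagnat.rank l (fun=> 2%N))) /=; last first.
  by apply: onW_bij; exists (@tagnat.sig l (fun=> 2%N));
    [exact: tagnat.rankK | exact: tagnat.sigK].
by apply: eq_bigr => t _; rewrite -[in RHS](@tagnat.rankK l (fun=> 2%N) t).
Qed.

Lemma I2_cases (a : 'I_2) : a = ord0 \/ a = o1.
Proof. by case: a => -[|[|//]] h; [left | right]; apply: val_inj. Qed.

Lemma sum_I2 (V : nmodType) (F : 'I_2 -> V) : \sum_c F c = F ord0 + F o1.
Proof.
rewrite !big_ord_recl big_ord0 addr0; congr (_ + F _); exact: val_inj.
Qed.

(** Blocks (i, j) and (j, i) contribute equally, since both the block and the bracket change sign;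
    this cancels the 1/2. A general [Y] covers the variables themselves and their images under
    [Tact]. *)
Lemma quad_Tmat (t : 'I_l -> 'I_l -> C) (Y : 'I_l -> 'I_2 -> poly_l) :
  2^-1 *: \sum_s \sum_s' Tmat t s s' *: (Y (bk s) (pos s) * Y (bk s') (pos s')) =
  \sum_(i < l) \sum_(j < l | (i < j)%N)
    t i j *: (Y i ord0 * Y j o1 - Y i o1 * Y j ord0).
Proof.
pose D (i j : 'I_l) : 'M[C]_2 := if (i < j)%N then skew2 (t i j)
                else if (j < i)%N then - skew2 (t j i) else 0.
pose W i j := t i j *: (Y i ord0 * Y j o1 - Y i o1 * Y j ord0).
have -> : \sum_s \sum_s' Tmat t s s' *: (Y (bk s) (pos s) * Y (bk s') (pos s')) =
    \sum_(i < l) \sum_(c < 2) \sum_(j < l) \sum_(c' < 2)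
      D i j c c' *: (Y i c * Y j c').
  rewrite -(sum_blocks (fun i c => \sum_(j < l) \sum_(c' < 2)
      D i j c c' *: (Y i c * Y j c'))).
  apply: eq_bigr => s _.
  rewrite -(sum_blocks (fun j c' => D (bk s) j (pos s) c' *: (Y (bk s) (pos s) * Y j c'))).
  by apply: eq_bigr => s' _; rewrite mxE.
transitivity (2^-1 *: \sum_(i < l) \sum_(j < l)
    ((if (i < j)%N then W i j else 0) + (if (j < i)%N then W j i else 0))).
  congr (_ *: _); apply: eq_bigr => i _; rewrite exchange_big /=.
  apply: eq_bigr => j _; rewrite !sum_I2 /D.
  case: ltngtP => ij; rewrite !mxE /= ?oppr0 ?opprK !scale0r ?addr0 ?add0r ?scaleNr //.
    by rewrite /W scalerBr.
  by rewrite /W scalerBr addrC [Y j ord0 * _]mulrC [Y j o1 * _]mulrC.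
under eq_bigr do rewrite big_split /=.
rewrite big_split /= [X in _ + X]exchange_big /= -[X in _ *: X]mulr2n -[X in _ *: X]scaler_nat.
rewrite scalerA mulVf ?pnatr_eq0 // scale1r.
by apply: eq_bigr => i _; rewrite -big_mkcond.
Qed.

Lemma UmatE (A : 'I_l -> 'M[C]_2) s s' :
  Umat A s s' = A (bk s) (pos s) (pos s') *+ (bk s == bk s').
Proof.
rewrite !mxE; case: eqP => [e|_]; last by rewrite mulr0n mxE.
by rewrite conform_mx_id mulr1n.
Qed.

(** The two signs cancel: each block is skew, and the blocks are arranged skew-symmetrically. *)
Lemma Tmat_sym (t : 'I_l -> 'I_l -> C) : (Tmat t)^T = Tmat t.
Proof.
have tr_skew c : (skew2 c : 'M[C]_2)^T = - skew2 c.
  apply/matrixP=> a b; rewrite !mxE.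
  by case: (I2_cases a) => ->; case: (I2_cases b) => ->;
    rewrite /= ?oppr0 ?opprK.
rewrite /Tmat tr_mxblock; apply: eq_mxblock => i j.
by case: ltngtP; rewrite ?trmx0 ?linearN /= ?tr_skew ?opprK.
Qed.

Lemma Tmat_conj (t : 'I_l -> 'I_l -> C) :
  Tmat (fun i j => Num.conj (t i j)) = map_mx Num.conj (Tmat t).
Proof.
have conj_skew c : map_mx Num.conj (skew2 c : 'M[C]_2) = skew2 (Num.conj c).
  apply/matrixP=> a b; rewrite !mxE.
  by do 2?[case: ifP => _]; rewrite ?rmorphN ?rmorph0.
apply/matrixP=> s s'; rewrite [LHS]mxE [RHS]mxE [Tmat t _ _]mxE.
case: ifP => _; first by rewrite -conj_skew mxE.
case: ifP => _; first by rewrite -conj_skew -map_mxN mxE.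
by rewrite !mxE rmorph0.
Qed.

Lemma Tmat_bound (t : 'I_l -> 'I_l -> C) (e : C) : 0 <= e ->
  (forall i j : 'I_l, (i < j)%N -> `|t i j| <= e) ->
  forall s s', `|Tmat t s s'| <= e.
Proof.
move=> e0 te s s'; have skew_le c a b : `|c| <= e -> `|(skew2 c : 'M[C]_2) a b| <= e.
  by move=> ce; rewrite mxE; do 2?[case: ifP => _]; rewrite ?normrN ?normr0.
rewrite mxE; case: ifP => [/te|_]; first exact: skew_le.
by case: ifP => [/te te'|_]; rewrite mxE ?normr0 // normrN skew_le.
Qed.

Definition uidx (s : 'I_N2) : 'I_(l * 2) := uvar (bk s) (pos s).

Definition ugrade (k : 'I_(l * 2)) : 'I_l :=
  (enum_val (cast_ord (esym (mxvec_cast l 2)) k)).1.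

Lemma ugrade_uvar (j : 'I_l) c : ugrade (uvar j c) = j.
Proof. by rewrite /ugrade /uvar /mxvec_index cast_ordK enum_rankK. Qed.

Lemma uvar_inj (j j' : 'I_l) c c' : uvar j c = uvar j' c' -> (j, c) = (j', c').
Proof. by move/cast_ord_inj/enum_rank_inj. Qed.

Lemma uidx_inj : injective uidx.
Proof.
move=> s s' /uvar_inj[bb pp]; apply: val_inj.
by rewrite /= (tagnat.rect s) (tagnat.rect s') bb pp.
Qed.

Variable A : 'I_l -> 'M[C]_2.

Definition yvar (j : 'I_l) (k : 'I_2) : poly_l :=
  \sum_(c < 2) 'X_(uvar j c) * (A j c k)%:MP.

Lemma Tact_uvar j k : Tact A 'X_(uvar j k) = yvar j k.
Proof.
rewrite /Tact comp_mpolyXU.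
by rewrite -tnth_nth tnth_mktuple mxvecE mxE.
Qed.

Lemma yvar_uidx s : yvar (bk s) (pos s) = \sum_s' Umat A s' s *: 'X_(uidx s').
Proof.
pose F i c : poly_l :=
  (A i c (pos s) *+ (i == bk s)) *: 'X_(uvar i c).
transitivity (\sum_s' F (bk s') (pos s')); last first.
  by apply: eq_bigr => s' _; rewrite UmatE.
rewrite sum_blocks (bigD1 (bk s)) //= [X in _ + X]big1 ?addr0 => [|i ii].
  by apply: eq_bigr => c _; rewrite /F eqxx mulr1n mulrC mul_mpolyC.
by apply: big1 => c _; rewrite /F (negbTE ii) mulr0n scale0r.
Qed.

(** The substitution u -> uU in the quadratic form of [T] yields that of U T U^t, the coordinates of
    uU being the [yvar]. *)
Lemma quad_conj_Umat (T : 'M[C]_N2) :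
  quad uidx (Umat A *m T *m (Umat A)^T) =
  2^-1 *: \sum_s \sum_s' T s s' *: (yvar (bk s) (pos s) * yvar (bk s') (pos s')).
Proof.
rewrite /quad; congr (_ *: _); symmetry.
transitivity (\sum_s \sum_s' \sum_p \sum_p'
   (T s s' * Umat A p s * Umat A p' s') *: ('X_(uidx p) * 'X_(uidx p')) : poly_l).
  apply: eq_bigr => s _; apply: eq_bigr => s' _; rewrite !yvar_uidx mulr_suml.
  rewrite scaler_sumr; apply: eq_bigr => p _; rewrite mulr_sumr scaler_sumr.
  by apply: eq_bigr => p' _; rewrite -scalerAl -scalerAr !scalerA.
under eq_bigr do rewrite exchange_big /=.
rewrite exchange_big /=; apply: eq_bigr => p _.
under eq_bigr do rewrite exchange_big /=.
rewrite exchange_big /=; apply: eq_bigr => p' _.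
rewrite mxE scaler_suml exchange_big /=; apply: eq_bigr => s' _.
rewrite !mxE mulr_suml scaler_suml; apply: eq_bigr => s _; congr (_ *: _); ring.
Qed.

End BlockForm.

(** * The generating function *)

Section GeneratingCoefficients.
Variables (R : rcfType) (l : nat) (A : 'I_l -> 'M[R[i]]_2).
Local Notation C := R[i].
Local Notation poly_l := {mpoly C[l * 2]}.
Local Notation gr := (@ugrade l).
Variables t t' : 'I_l -> 'I_l -> C.
Local Notation S := (Umat A *m Tmat t *m (Umat A)^T).
Local Notation T' := (Tmat t').

Let x i j := t i j *: Tact A (xi R i j).
Let x' i j := t' i j *: xi R i j.

Let wt (u : 'I_l -> 'I_l -> C) (al : 'M[nat]_l) : C :=
  \prod_(i < l) \prod_(j < l | (i < j)%N) (u i j ^+ al i j / (al i j)`!%:R).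

Lemma xprod_scale (u : 'I_l -> 'I_l -> C) (v : 'I_l -> 'I_l -> poly_l) al :
  xprod (fun i j => u i j *: v i j) al =
  wt u al *: \prod_(i < l) \prod_(j < l | (i < j)%N) v i j ^+ al i j.
Proof.
rewrite /xprod /wt -scaler_prod; apply: eq_bigr => i _.
rewrite -scaler_prod; apply: eq_bigr => j _.
by rewrite /divpow exprZn scalerA mulrC.
Qed.

Lemma Tact_Xi al : Tact A (Xi R al) =
  \prod_(i < l) \prod_(j < l | (i < j)%N) Tact A (xi R i j) ^+ al i j.
Proof.
rewrite /Xi /Tact rmorph_prod /=; apply: eq_bigr => i _.
rewrite rmorph_prod /=; apply: eq_bigr => j _.
exact: rmorphXn.
Qed.

Lemma weightE al be : weight t t' al be = wt t al * Num.conj (wt t' be).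
Proof.
rewrite /weight /wt rmorph_prod -big_split; apply: eq_bigr => i _ /=.
rewrite rmorph_prod -big_split; apply: eq_bigr => j _ /=.
rewrite natrM invfM [in RHS]rmorphM /= fmorphV rmorph_nat rmorphXn /=; ring.
Qed.

Lemma gen_coef_component (a : {ffun 'I_l -> nat}) :
  gen_coef t t' A a = fpair (component x a) (component x' a).
Proof.
rewrite /gen_coef /component fpair_suml; apply: eq_bigr => al _.
rewrite fpair_sumr; apply: eq_bigr => be _.
rewrite !xprod_scale fpairZl fpairZr weightE -mulrA; congr (_ * (_ * _)).
by rewrite -Tact_Xi.
Qed.

Lemma Tact_xi i j :
  Tact A (xi R i j) = yvar A i ord0 * yvar A j o1 - yvar A i o1 * yvar A j ord0.
Proof. by rewrite /xi -!Tact_uvar /Tact rmorphB !rmorphM. Qed.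

Lemma multihomog_uvar j c :
  multihomog gr (edeg j) ('X_(uvar j c) : poly_l).
Proof.
have -> : edeg j = [ffun k => nat_of_bool (gr (uvar j c) == k)].
  by apply/ffunP=> k; rewrite !ffunE ugrade_uvar.
exact: multihomogX.
Qed.

Lemma multihomog_yvar j c : multihomog gr (edeg j) (yvar A j c).
Proof.
apply: multihomog_sum => k _; rewrite mulrC mul_mpolyC.
by apply: multihomogZ; apply: multihomog_uvar.
Qed.

Lemma multihomogB a (f g : poly_l) :
  multihomog gr a f -> multihomog gr a g -> multihomog gr a (f - g).
Proof.
by move=> fa ga; rewrite -scaleN1r; apply: multihomogD => //; apply: multihomogZ.
Qed.

Lemma x_homog i j : multihomog gr (edeg i + edeg j) (x i j).
Proof.
rewrite /x Tact_xi; apply/multihomogZ/multihomogB;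
  by apply: multihomogM; apply: multihomog_yvar.
Qed.

Lemma x'_homog i j : multihomog gr (edeg i + edeg j) (x' i j).
Proof.
by apply/multihomogZ/multihomogB; apply: multihomogM; apply: multihomog_uvar.
Qed.

Lemma xsum_x : xsum x = quad (@uidx l) S.
Proof.
rewrite quad_conj_Umat quad_Tmat; apply: eq_bigr => i _; apply: eq_bigr => j _.
by rewrite /x Tact_xi.
Qed.

Lemma xsum_x' : xsum x' = quad (@uidx l) T'.
Proof. exact: esym (quad_Tmat t' (fun i c => 'X_(uvar i c))). Qed.

Lemma quad_homog (Q : 'M[C]_(\sum_(i < l) 2)) : quad (@uidx l) Q \is 2.-homog.
Proof.
apply: dhomogZ; apply: rpred_sum => s _; apply: rpred_sum => s' _.
apply: dhomogZ; rewrite -mpolyXD dhomogX /= mdegD !mdeg1 //.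
Qed.

Lemma divpow_homog (q : poly_l) m : q \is 2.-homog -> divpow q m \is m.*2.-homog.
Proof. by move=> q2; apply: dhomogZ; rewrite -mul2n dhomogMn. Qed.

(** By degree only m equal to half of the total of [a] contributes, and none if that total is odd.
    Summing up to any large [K] gives one range for a whole box, so the sums over [m] and over the
    box can be exchanged. *)
Lemma gen_coef_sum (a : {ffun 'I_l -> nat}) K : (\sum_i a i < K)%N ->
  gen_coef t t' A a = \sum_(m < K)
    fpair (proj gr a (divpow (quad (@uidx l) S) m))
          (proj gr a (divpow (quad (@uidx l) T') m)).
Proof.
move=> aK; rewrite gen_coef_component.
have fp0 m g : (\sum_i a i)%N != m.*2 ->
    fpair (proj gr a (divpow (quad (@uidx l) S) m)) g = 0.
  move=> am; have p2 := divpow_homog m (quad_homog S).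
  by rewrite (proj_dhomog _ p2 am) fpair0l.
have xh (i j : 'I_l) (_ : (i < j)%N) := @x_homog i j.
have x'h (i j : 'I_l) (_ : (i < j)%N) := @x'_homog i j.
have [oa|ea] := boolP (odd (\sum_i a i)%N).
  rewrite (component_odd x oa) fpair0l big1 // => m _.
  by apply: fp0; apply: contraTneq oa => ->; rewrite odd_double.
pose m0 := (\sum_i a i)%N./2.
have aE : (\sum_i a i)%N = m0.*2 by rewrite even_halfK.
have m0K : (m0 < K)%N by apply: leq_ltn_trans aK; rewrite aE -addnn leq_addr.
rewrite (component_even xh aE) (component_even x'h aE) xsum_x xsum_x'.
rewrite [RHS](bigD1 (Ordinal m0K)) //= [X in _ + X]big1 ?addr0 // => m mm0.
apply: fp0; rewrite aE; apply: contra mm0 => /eqP/double_inj/esym mE.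
by apply/eqP/val_inj.
Qed.

Hypotheses (cSS : forall m, `|gcoef (@uidx l) S S m| <= 4^-1 ^+ m)
  (cTT : forall m, `|gcoef (@uidx l) T' T' m| <= 4^-1 ^+ m).

Let h m (a : {ffun 'I_l -> nat}) :=
    fpair (proj gr a (divpow (quad (@uidx l) S) m))
          (proj gr a (divpow (quad (@uidx l) T') m)).

Lemma sum_norm_h N m :
  \sum_(k : {ffun 'I_l -> 'I_N}) `|h m (inbox k)| <= 4^-1 ^+ m.
Proof.
apply: (@le_trans _ _ (\sum_(k : {ffun 'I_l -> 'I_N}) 2^-1 *
   (fpair (proj gr (inbox k) (divpow (quad (@uidx l) S) m))
      (proj gr (inbox k) (divpow (quad (@uidx l) S) m)) +
    fpair (proj gr (inbox k) (divpow (quad (@uidx l) T') m))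
      (proj gr (inbox k) (divpow (quad (@uidx l) T') m))))).
  by apply: ler_sum => k _; apply: fpair_amgm.
rewrite -mulr_sumr big_split /=.
have half2 (z : C) : z = 2^-1 * (z + z) by field.
rewrite [leRHS]half2 ler_wpM2l ?invr_ge0 ?ler0n //.
by apply: lerD; apply: le_trans (sum_fpair_proj_le _ _ _) _;
  [have := cSS m | have := cTT m]; rewrite ger0_norm // /gcoef fpair_ge0.
Qed.

Let inbox_lt N (k : {ffun 'I_l -> 'I_N}) : (\sum_i inbox k i < (l * N).+1)%N.
Proof.
rewrite ltnS (@leq_trans (\sum_(i < l) N)) //.
  by apply: leq_sum => i _; rewrite ffunE; apply: ltnW; apply: ltn_ord.
by rewrite sum_nat_const card_ord.
Qed.

Lemma sum_norm_gen_coef N :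
  \sum_(k : {ffun 'I_l -> 'I_N}) `|gen_coef t t' A (inbox k)| <= 2.
Proof.
pose K := (l * N).+1.
apply: (@le_trans _ _ (\sum_(k : {ffun 'I_l -> 'I_N}) \sum_(m < K) `|h m (inbox k)|)).
  apply: ler_sum => k _; rewrite (gen_coef_sum (inbox_lt k)).
  exact: ler_norm_sum.
rewrite exchange_big /= (le_trans _ (geom_half_le C K)) //.
apply: ler_sum => m _; rewrite (le_trans (sum_norm_h _ _)) //.
by rewrite lerXn2r ?nnegrE ?invr_ge0 ?ler0n // lef_pV2 ?posrE ?ltr0n // ler_nat.
Qed.

(** For m <= n every multidegree of total 2m lies in the box, so the sum over the box is exactly
    c_m; the terms m > n are bounded by a geometric tail. *)
Lemma sum_gen_coef_approx N n : (n.*2 < N)%N -> (0 < l)%N ->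
  `|\sum_(k : {ffun 'I_l -> 'I_N}) gen_coef t t' A (inbox k) -
    \sum_(m < n.+1) gcoef (@uidx l) S T' m| <= 2 / 2 ^+ n.
Proof.
move=> nN l0; pose K := (l * N).+1.
have nK : (n.+1 <= K)%N by rewrite /K; nia.
have -> : \sum_(k : {ffun 'I_l -> 'I_N}) gen_coef t t' A (inbox k) =
    \sum_(m < K) \sum_(k : {ffun 'I_l -> 'I_N}) h m (inbox k).
  rewrite exchange_big /=; apply: eq_bigr => k _.
  exact: (gen_coef_sum (inbox_lt k)).
pose H m := \sum_(k : {ffun 'I_l -> 'I_N}) h m (inbox k).
have -> : \sum_(m < n.+1) gcoef (@uidx l) S T' m = \sum_(m < n.+1) H m.
  apply: eq_bigr => m _; rewrite /H /h (@sum_fpair_proj_eq _ _ _ _ N m.*2) //.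
    exact/divpow_homog/quad_homog.
  by apply: leq_ltn_trans nN; rewrite leq_double -ltnS.
rewrite -!(big_mkord xpredT H) (big_cat_nat _ nK) //= addrAC subrr add0r.
rewrite (le_trans (ler_norm_sum _ _ _)) //.
apply: (@le_trans _ _ (\sum_(n.+1 <= m < K) 2^-1 ^+ m / 2 ^+ n)).
  rewrite big_nat [leRHS]big_nat; apply: ler_sum => m /andP[nm _].
  rewrite (le_trans (ler_norm_sum _ _ _)) // (le_trans (sum_norm_h _ _)) //.
  (* One factor 2^-m gives the decay 2^-n of the tail, the other keeps the sum bounded by 2. *)
  have -> : 4^-1 = 2^-1 * 2^-1 :> C by field.
  rewrite exprMn -exprVn ler_wpM2l ?exprn_ge0 ?invr_ge0 ?ler0n //.
  by rewrite ler_wiXn2l ?invr_ge0 ?ler0n ?invf_le1 ?ltr0n ?ler1n // ltnW.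
rewrite -mulr_suml ler_wpM2r ?invr_ge0 ?exprn_ge0 ?ler0n //.
rewrite (le_trans _ (geom_half_le C K)) // -(big_mkord xpredT (fun m => 2^-1 ^+ m)).
rewrite [leRHS](big_cat_nat _ nK) //= lerDr sumr_ge0 // => m _.
by rewrite exprn_ge0 ?invr_ge0 ?ler0n.
Qed.

End GeneratingCoefficients.

(** * Selecting the branch of the square root *)

Section PrincipalRoot.
Variable R : rcfType.
Local Notation C := R[i].

Lemma psqrt_sqr (z : C) : psqrt z ^+ 2 = z.
Proof. by rewrite /psqrt; case: ifP => _; rewrite ?sqrrN sqrtCK. Qed.

Lemma Re_psqrt_ge0 (z : C) : 0 <= 'Re (psqrt z).
Proof.
rewrite /psqrt; set w := sqrtC z; case: ifP => [w0|/negbT].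
  by rewrite raddfN oppr_ge0 ltW.
by rewrite -real_leNgt // Creal_Re.
Qed.

Lemma Re_inv_ge0 (z : C) : 0 <= 'Re z -> 0 <= 'Re z^-1.
Proof.
move=> z0; rewrite invC_norm ReMl ?rpredV ?rpredX ?normr_real //.
by rewrite Re_conj mulr_ge0 ?invr_ge0 ?exprn_ge0.
Qed.

Lemma Re_le_norm (z : C) : 'Re z <= `|z|.
Proof.
apply: le_trans (real_ler_norm (Creal_Re z)) _.
by have [] := leif_normC_Re_Creal z.
Qed.

(** Factor s^2 - w^2 = (s - w)(s + w). As [s] has real part at least 1/2 and [w] a nonnegative one,
    |s + w| >= 1/2, which excludes the root -w. *)
Lemma psqrt_inv_approx (s D e : C) : D != 0 ->
  `|s ^+ 2 * D - 1| <= e -> `|s - 1| <= 2^-1 -> `|s - (psqrt D)^-1| <= 2 * e / `|D|.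
Proof.
move=> D0 sD s1; set w := (psqrt D)^-1.
have w2 : w ^+ 2 = D^-1 by rewrite exprVn psqrt_sqr.
have sw : 2^-1 <= `|s + w|.
  apply: le_trans (Re_le_norm _); rewrite raddfD /=.
  have Rw : 0 <= 'Re w by exact/Re_inv_ge0/Re_psqrt_ge0.
  apply: le_trans (_ : 'Re s <= _); last by rewrite lerDl.
  have -> : s = 1 - (1 - s) by rewrite subKr.
  have := le_trans (Re_le_norm (1 - s)) _; rewrite distrC => /(_ _ s1) h.
  rewrite raddfB /= (Creal_ReP 1 _) ?rpred1 // lerBrDr -lerBrDl.
  by rewrite (le_trans h) // lerBrDr; have -> : 2^-1 + 2^-1 = 1 :> C by field.
have key : `|s - w| * `|s + w| <= e / `|D|.
  rewrite -normrM -subr_sqr w2 -[X in `|X|](_ : (s ^+ 2 * D - 1) / D = _).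
    by rewrite normrM normfV ler_wpM2r // invr_ge0.
  by rewrite mulrBl mulfK // mul1r.
have h2 : `|s - w| * 2^-1 <= e / `|D|.
  by apply: le_trans key; rewrite ler_wpM2l.
have -> : `|s - w| = 2 * (`|s - w| * 2^-1) by rewrite mulrCA divff ?mulr1 // pnatr_eq0.
by rewrite -mulrA ler_wpM2l ?ler0n.
Qed.

End PrincipalRoot.

Lemma exists_expn2_gt (R : realType) (z : R[i]) : 0 <= z -> exists n, z < 2 ^+ n.
Proof.
move=> z0; pose r := complex.Re z; exists (Num.bound r).
have -> : z = r%:C%C by rewrite RRe_real // ger0_real.
have := @upper_nthrootP _ r _ (leqnn _); rewrite -ltcR rmorphXn /=.
by rewrite rmorph_nat.
Qed.

Lemma partial_sum_near1 (C : numFieldType) (c : nat -> C) N : c 0%N = 1 ->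
  (forall m, `|c m| <= 4^-1 ^+ m) -> `|\sum_(m < N.+1) c m - 1| <= 2^-1.
Proof.
move=> c0 cb; rewrite big_ord_recl c0 addrAC subrr add0r.
rewrite (le_trans (ler_norm_sum _ _ _)) //.
apply: (@le_trans _ _ (\sum_(m < N) 4^-1 * 2^-1 ^+ m)).
  apply: ler_sum => m _; rewrite (le_trans (cb _)) // exprS.
  rewrite ler_wpM2l ?invr_ge0 ?ler0n // lerXn2r ?nnegrE ?invr_ge0 ?ler0n //.
  by rewrite lef_pV2 ?posrE ?ltr0n // ler_nat.
rewrite [leRHS](_ : _ = 4^-1 * 2); last by field.
by rewrite -mulr_sumr ler_wpM2l ?invr_ge0 ?ler0n // geom_half_le.
Qed.

(** The total of the norms of all entries of [U] dominates each row sum; the added 1 makes the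
    constant at least 1, so that one may divide by it. *)
Lemma conj_Umat_bound (R : rcfType) (d : nat) (U T : 'M[R[i]]_d) (e : R[i]) :
  0 <= e -> (forall s s', `|T s s'| <= e) -> forall s s',
  `|(U *m T *m U^T) s s'| <= e * (1 + \sum_p \sum_q `|U p q|) ^+ 2.
Proof.
move=> e0 Te s s'; set k := 1 + _.
have row_le p : \sum_q `|U p q| <= k.
  rewrite /k [X in _ <= _ + X](bigD1 p) //= addrCA lerDl addr_ge0 ?sumr_ge0 // => q _.
  exact: sumr_ge0.
have k0 : 0 <= k by apply: le_trans (row_le s); apply: sumr_ge0.
rewrite mxE (le_trans (ler_norm_sum _ _ _)) //.
apply: (@le_trans _ _ (\sum_q' (\sum_q `|U s q|) * e * `|U s' q'|)).
  apply: ler_sum => q' _; rewrite normrM !mxE ler_wpM2r //.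
  rewrite (le_trans (ler_norm_sum _ _ _)) // mulr_suml ler_sum // => q _.
  by rewrite normrM ler_wpM2l.
rewrite -mulr_sumr expr2 mulrA [e * k]mulrC ler_pM ?row_le //.
- by rewrite mulr_ge0 // sumr_ge0.
- exact: sumr_ge0.
by rewrite ler_wpM2r.
Qed.

Lemma psqrt_inv_limit (R : realType) (s : nat -> R[i]) (D K : R[i]) :
  0 <= K -> (forall n, `|s n ^+ 2 * D - 1| <= K / 2 ^+ n) ->
  (forall n, `|s n - 1| <= 2^-1) ->
  forall e, 0 < e -> exists n, 2 / 2 ^+ n + `|s n - (psqrt D)^-1| < e.
Proof.
move=> K0 sK s1 e e0.
(* If [D] were 0, the hypothesis would read 1 <= K / 2^n for all n. *)
have D0 : D != 0.
  apply/eqP => D0; have [n Kn] := exists_expn2_gt K0.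
  have := sK n; rewrite D0 mulr0 sub0r normrN normr1.
  by rewrite ler_pdivlMr ?exprn_gt0 ?ltr0n // mul1r => /(lt_le_trans Kn); rewrite ltxx.
pose L := 2 + 2 * K / `|D|.
have L0 : 0 <= L by rewrite addr_ge0 ?divr_ge0 ?mulr_ge0 ?ler0n.
have [n Ln] : exists n, L / e < 2 ^+ n.
  by apply: exists_expn2_gt; rewrite divr_ge0 // ltW.
exists n; apply: (@le_lt_trans _ _ (L / 2 ^+ n)); last first.
  by rewrite ltr_pdivrMr ?exprn_gt0 ?ltr0n // mulrC -ltr_pdivrMr.
rewrite /L [leRHS]mulrDl lerD // (le_trans (psqrt_inv_approx D0 (sK n) (s1 n))) //.
by rewrite !mulrA mulrAC.
Qed.

Theorem theorem4p1 (R : realType) (l : nat) (hl : (2 <= l)%N)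
  (A : 'I_l -> 'M[R[i]]_2) (hA : forall j, is_SU2 (A j)) :
  exists eps : R[i], 0 < eps /\
  forall t t' : 'I_l -> 'I_l -> R[i],
    (forall i j : 'I_l, (i < j)%N -> `|t i j| < eps /\ `|t' i j| < eps) ->
    let c := gen_coef t t' A in
    let rhs := (psqrt (\det (1%:M - Umat A *m Tmat t *m (Umat A)^T
                                    *m Tmat (fun i j => Num.conj (t' i j)))))^-1 in
    (* absolute convergence of the multi-index series over n in N^l *)
    (exists M : R[i], forall N : nat,
        \sum_(n : {ffun 'I_l -> 'I_N}) `|c (fun i => val (n i))| <= M) /\
    (* its sum (limit of the partial sums over the boxes [0,N)^l) is rhs *)
    (forall e : R[i], 0 < e -> exists N0 : nat, forall N : nat, (N0 <= N)%N ->
        `|\sum_(n : {ffun 'I_l -> 'I_N}) c (fun i => val (n i)) - rhs| < e).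
Proof.
pose d := (\sum_(i < l) 2)%N.
have l0 : (0 < l)%N by exact: leq_trans hl.
have d0 : (0 < d)%N by rewrite /d sum_nat_const card_ord muln_gt0 l0.
pose kappa : R[i] := 1 + \sum_p \sum_q `|Umat A p q|.
have kappa1 : 1 <= kappa.
  by rewrite lerDl sumr_ge0 // => p _; rewrite sumr_ge0.
have kappa0 : 0 < kappa by apply: lt_le_trans kappa1.
(* With this [b], d^3 b^2 = 1 / (4 d) <= 1/4, as [gcoef_bound] requires. Dividing by [kappa ^+ 2]
   then bounds the entries of [S] by [b], and those of [T'] too because [kappa] is at least 1. *)
pose b : R[i] := (2 * d%:R ^+ 2)^-1.
have b0 : 0 < b by rewrite invr_gt0 mulr_gt0 ?exprn_gt0 ?ltr0n.
exists (b / kappa ^+ 2); split; first by rewrite divr_gt0 ?exprn_gt0.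
set eps := b / _ => t t' tt' c rhs.
have eps0 : 0 <= eps by rewrite ltW // divr_gt0 ?exprn_gt0.
pose S := Umat A *m Tmat t *m (Umat A)^T; pose T' := Tmat t'.
have Sb s s' : `|S s s'| <= b.
  have -> : b = eps * kappa ^+ 2 by rewrite /eps divfK // expf_neq0 // gt_eqF.
  apply: conj_Umat_bound => //; apply: Tmat_bound => // i j ij.
  by apply: ltW; have [] := tt' i j ij.
have Tb s s' : `|T' s s'| <= b.
  apply: (@le_trans _ _ eps); last first.
    rewrite ler_pdivrMr ?exprn_gt0 // ler_peMr //; first exact: ltW.
    exact: exprn_ege1.
  apply: Tmat_bound => // i j ij.
  by apply: ltW; have [] := tt' i j ij.
have bb : (d ^ 3)%:R * (b * b) <= 4^-1.
  have dn0 : d%:R != 0 :> R[i] by rewrite pnatr_eq0 -lt0n.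
  have -> : (d ^ 3)%:R * (b * b) = 4^-1 / d%:R :> R[i].
    by rewrite /b natrX; field.
  by rewrite ler_pdivrMr ?ltr0n // ler_peMr ?invr_ge0 ?ler0n // ler1n.
have symS : S^T = S by rewrite /S !trmx_mul trmxK Tmat_sym mulmxA.
have symT : T'^T = T' := Tmat_sym t'.
have inj := @uidx_inj l; have bge0 := ltW b0.
(* The squared norms [cSS] and [cTT] control absolute convergence and the tails; [cST] concerns the
   series to be summed. *)
have cSS := gcoef_bound inj symS symS bge0 bge0 Sb Sb bb.
have cTT := gcoef_bound inj symT symT bge0 bge0 Tb Tb bb.
have cST := gcoef_bound inj symS symT bge0 bge0 Sb Tb bb.
have boxE N (k : {ffun 'I_l -> 'I_N}) : (fun i => val (k i)) = inbox k.
  by apply: boolp.funext => i; rewrite ffunE.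
split.
  exists 2 => N; rewrite (eq_bigr _ (fun k _ => congr1 (fun n => `|c n|) (boxE N k))).
  exact: (@sum_norm_gen_coef R l A t t' cSS cTT N).
pose D := \det (1%:M - S *m map_mx Num.conj T').
have rhsE : rhs = (psqrt D)^-1 by rewrite /rhs Tmat_conj.
have [K [K0 sK]] := partial_sum_sqr_det (gcoef0 _ S T') (gmat0 inj S T')
  (gmatS inj symS symT) (gcoefS inj symS symT) cST.
have symB : (map_mx Num.conj T')^T = map_mx Num.conj T'.
  by rewrite map_trmx symT.
have detE : \det (1%:M - map_mx Num.conj T' *m S) = D.
  exact: det_1sub_mul_sym symB symS.
rewrite detE in sK.
pose s n := \sum_(m < n.+1) gcoef (@uidx l) S T' m.
have s1 n : `|s n - 1| <= 2^-1 := partial_sum_near1 n (gcoef0 _ S T') cST.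
move=> e e0; have [n ne] := psqrt_inv_limit K0 sK s1 e0.
(* A box of side greater than 2n contains every multidegree of total at most 2n. *)
exists n.*2.+1 => N nN.
rewrite (eq_bigr _ (fun k _ => congr1 c (boxE N k))) rhsE.
have approx := @sum_gen_coef_approx R l A t t' cSS cTT N n nN l0.
exact: le_lt_trans (ler_distD (s n) _ _) (le_lt_trans (lerD approx (lexx _)) ne).
Qed.
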